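(* Every finitely presented group occurs as the digital fundamental group of some digital image. That is, for every finitely presented group $G$ there exist a digital image $X$ and a basepoint $x_0\in X$ such that $\pi_1(X;x_0)\cong G$.
   Context: A digital image is a finite subset $X\subseteq\mathbb{Z}^n$ (for some $n$) with the adjacency relation $x\sim_X y$ iff $|x_i-y_i|\le 1$ for all $i=1,\ldots,n$ (reflexive and symmetric). A based digital image also has a chosen basepoint $x_0\in X$. A function $f\colon X\to Y$ of digital images is continuous if $x\sim_X x'$ implies $f(x)\sim_Y f(x')$. For $N\ge 0$, $I_N=\{0,1,\ldots,N\}\subseteq\mathbb{Z}$. Products carry the adjacency $(x,y)\sim(x',y')$ iff $x\sim x'$ and $y\sim y'$. A based loop of length $N$ in $X$ is a continuous $\alpha\colon I_N\to X$ with $\alpha(0)=\alpha(N)=x_0$. Based loops $\alpha,\beta\colon I_M\to X$ of the same length are based homotopic as based loops, $\alpha\approx\beta$, if for some $R\ge1$ there is a continuous $H\colon I_M\times I_R\to X$ with $H(s,0)=\alpha(s)$, $H(s,R)=\beta(s)$ and $H(0,t)=H(M,t)=x_0$ for all $s,t$. For $k\ge1$ let $\rho_k\colon I_{kN+k-1}\to I_N$, $\rho_k(i)=\lfloor i/k\rfloor$. Based loops $\alpha\colon I_M\to X$, $\beta\colon I_N\to X$ are subdivision-based homotopic if for some $k,l\ge1$ with $k(M+1)=l(N+1)$ we have $\alpha\circ\rho_k\approx\beta\circ\rho_l$ as based loops. This is an equivalence relation on the based loops of all lengths; the digital fundamental group $\pi_1(X;x_0)$ is the set of classes $[\alpha]$.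 It is a group under $[\alpha]\cdot[\beta]=[\alpha\cdot\beta]$, where for $\alpha\colon I_M\to X$, $\beta\colon I_N\to X$ the loop $\alpha\cdot\beta\colon I_{M+N+1}\to X$ equals $\alpha(t)$ for $0\le t\le M$ and $\beta(t-(M+1))$ for $M+1\le t\le M+N+1$; the identity is the class of constant loops, and inverses are given by reversing loops. *)

(* Defs.v *)
From HB Require Import structures.
From mathcomp Require Import all_boot all_order all_algebra.
From mathcomp Require Import finmap boolp zify.

Set Implicit Arguments.
Unset Strict Implicit.
Unset Printing Implicit Defensive.

Import Order.TTheory GRing.Theory Num.Theory.

Definition isomorphic (G H : groupType) : Prop :=
  exists2 f : G -> H, bijective f & {morph f : x y / (x * y)%g}.

Section Presentation.
Variable k : nat.

(* The letter (i, true) is the generator x_i, and (i, false) is its inverse. *)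
Definition word := seq ('I_k * bool).

Definition winv (w : word) : word := rev [seq (a.1, ~~ a.2) | a <- w].

Variable R : seq word.

(* Freely cancelling inverse letters and deleting relators generate the
   congruence whose quotient is F(x_0, ..., x_(k-1)) / <<R>>. *)
Inductive pres_equiv : word -> word -> Prop :=
| PresRefl u : pres_equiv u u
| PresSym u v : pres_equiv u v -> pres_equiv v u
| PresTrans u v w : pres_equiv u v -> pres_equiv v w -> pres_equiv u w
| PresCancel u v i b : pres_equiv (u ++ (i, b) :: (i, ~~ b) :: v) (u ++ v)
| PresRel u v r : r \in R -> pres_equiv (u ++ r ++ v) (u ++ v).

Definition pres_rel : rel word := fun u v => `[< pres_equiv u v >].

Lemma pres_rel_refl : reflexive pres_rel.
Proof. by move=> u; apply/asboolP/PresRefl. Qed.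

Lemma pres_rel_sym : symmetric pres_rel.
Proof. by move=> u v; apply/asboolP/asboolP; apply: PresSym. Qed.

Lemma pres_rel_trans : transitive pres_rel.
Proof.
by move=> v u w /asboolP uv /asboolP vw; apply/asboolP/(PresTrans uv vw).
Qed.

Canonical pres_equiv_rel :=
  EquivRel pres_rel pres_rel_refl pres_rel_sym pres_rel_trans.

Definition presented : Type := {eq_quot pres_equiv_rel}%qT.
HB.instance Definition _ := Choice.on presented.

Definition pres_class (w : word) : presented := (\pi_{eq_quot pres_equiv_rel} w)%qT.
Definition pres_repr (x : presented) : word :=
  repr (x : {eq_quot pres_equiv_rel}%qT).

Lemma pres_classP u v : pres_class u = pres_class v <-> pres_equiv u v.
Proof.
by split=> [/eqmodP/asboolP // | uv]; apply/eqmodP/asboolP.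
Qed.

Lemma pres_reprK : cancel pres_repr pres_class.
Proof. by move=> x; apply: reprK. Qed.

Lemma pres_repr_class w : pres_equiv (pres_repr (pres_class w)) w.
Proof. by apply/pres_classP; rewrite pres_reprK. Qed.

Lemma pres_ctx s t u v : pres_equiv u v -> pres_equiv (s ++ u ++ t) (s ++ v ++ t).
Proof.
elim=> {u v} [u|u v _|u v w _ uv _ vw|u v i b|u v r rR].
- exact: PresRefl.
- exact: PresSym.
- exact: PresTrans uv vw.
- rewrite -!catA /= 2!(catA s u); exact: PresCancel.
- rewrite -!catA 2!(catA s u); exact: PresRel.
Qed.

Lemma pres_cat u u' v v' :
  pres_equiv u u' -> pres_equiv v v' -> pres_equiv (u ++ v) (u' ++ v').
Proof.
move=> uu' vv'; apply: (PresTrans (v := u' ++ v)).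
  exact: (pres_ctx [::] v uu').
by have := pres_ctx u' [::] vv'; rewrite !cats0.
Qed.

Lemma winv_cons a w : winv (a :: w) = winv w ++ [:: (a.1, ~~ a.2)].
Proof. by rewrite /winv /= rev_cons cats1. Qed.

Lemma winv_cat u v : winv (u ++ v) = winv v ++ winv u.
Proof. by rewrite /winv map_cat rev_cat. Qed.

Lemma winvK : involutive winv.
Proof.
move=> w; rewrite /winv map_rev revK -map_comp -[RHS]map_id.
by apply: eq_map => -[i b] /=; rewrite negbK.
Qed.

Lemma pres_mulVw w : pres_equiv (winv w ++ w) [::].
Proof.
elim: w => [|[i b] w IH]; first exact: PresRefl.
rewrite winv_cons -catA /=; apply: PresTrans IH.
by have := PresCancel (winv w) w i (~~ b); rewrite negbK.
Qed.

Lemma pres_mulwV w : pres_equiv (w ++ winv w) [::].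
Proof. by have := pres_mulVw (winv w); rewrite winvK. Qed.

Lemma pres_winv u v : pres_equiv u v -> pres_equiv (winv u) (winv v).
Proof.
move=> uv; apply: (PresTrans (v := winv u ++ (v ++ winv v))).
  rewrite -[X in pres_equiv X _]cats0; apply: pres_cat; first exact: PresRefl.
  exact/PresSym/pres_mulwV.
rewrite catA -[X in pres_equiv _ X]cat0s; apply: pres_cat; last exact: PresRefl.
apply: PresTrans (pres_mulVw u); apply: pres_cat; first exact: PresRefl.
exact: PresSym.
Qed.

Definition pres_one := pres_class [::].
Definition pres_mul x y := pres_class (pres_repr x ++ pres_repr y).
Definition pres_inv x := pres_class (winv (pres_repr x)).

Lemma pres_mulE u v :
  pres_mul (pres_class u) (pres_class v) = pres_class (u ++ v).
Proof. by apply/pres_classP/pres_cat; apply: pres_repr_class. Qed.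

Lemma pres_invE u : pres_inv (pres_class u) = pres_class (winv u).
Proof. exact/pres_classP/pres_winv/pres_repr_class. Qed.

Lemma pres_mulA : associative pres_mul.
Proof.
move=> x y z; rewrite -(pres_reprK x) -(pres_reprK y) -(pres_reprK z).
by rewrite !pres_mulE catA.
Qed.

Lemma pres_mul1 : left_id pres_one pres_mul.
Proof. by move=> x; rewrite -(pres_reprK x) pres_mulE. Qed.

Lemma pres_mulr1 : right_id pres_one pres_mul.
Proof. by move=> x; rewrite -(pres_reprK x) pres_mulE cats0. Qed.

Lemma pres_mulV : left_inverse pres_one pres_inv pres_mul.
Proof.
move=> x; rewrite -(pres_reprK x) pres_invE pres_mulE.
exact/pres_classP/pres_mulVw.
Qed.

Lemma pres_mulrV : right_inverse pres_one pres_inv pres_mul.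
Proof.
move=> x; rewrite -(pres_reprK x) pres_invE pres_mulE.
exact/pres_classP/pres_mulwV.
Qed.

HB.instance Definition _ := isGroup.Build presented
  pres_mulA pres_mul1 pres_mulr1 pres_mulV pres_mulrV.

End Presentation.

Definition finitely_presented (G : groupType) : Prop :=
  exists (k : nat) (R : seq (word k)), isomorphic G (presented R).

Definition adjacent n : rel 'rV[int]_n :=
  fun x y => [forall i, (`|x ord0 i - y ord0 i| <= 1)%R].

Definition image_adj n (X : {fset 'rV[int]_n}) : rel X :=
  fun x y => adjacent (val x) (val y).

(* 'I_N.+1 is the interval I_N = {0, ..., N} in Z. *)
Definition interval_adj N : rel 'I_N.+1 :=
  fun i j => (`|(i : int) - (j : int)| <= 1)%R.

Definition prod_adj (S T : Type) (eS : rel S) (eT : rel T) : rel (S * T) :=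
  fun x y => eS x.1 y.1 && eT x.2 y.2.

Definition digital_continuous (S : finType) (T : Type) (eS : rel S) (eT : rel T)
    (f : S -> T) : bool :=
  [forall s, forall s', eS s s' ==> eT (f s) (f s')].

(* Floor division by k; L and N are such that L.+1 = k * N.+1 in every use, so
   that the value is at most N and inord does not truncate. *)
Definition rho (L N k : nat) (i : 'I_L.+1) : 'I_N.+1 := inord (i %/ k).

Section Loops.
Variables (n : nat) (X : {fset 'rV[int]_n}) (x0 : X).

Definition is_based_loop N (f : {ffun 'I_N.+1 -> X}) : bool :=
  [&& digital_continuous (@interval_adj N) (@image_adj n X) f,
      f ord0 == x0 & f ord_max == x0].

Definition loop (N : nat) : Type := {f : {ffun 'I_N.+1 -> X} | is_based_loop f}.
Definition loop_fun N (a : loop N) : 'I_N.+1 -> X := val a.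
Coercion loop_fun : loop >-> Funclass.
HB.instance Definition _ N := Choice.on (loop N).

Definition based_homotopic M (a b : 'I_M.+1 -> X) : Prop :=
  exists R, 0 < R /\ exists H : 'I_M.+1 * 'I_R.+1 -> X,
    [/\ digital_continuous (prod_adj (@interval_adj M) (@interval_adj R))
          (@image_adj n X) H,
        forall s, H (s, ord0) = a s /\ H (s, ord_max) = b s &
        forall t, H (ord0, t) = x0 /\ H (ord_max, t) = x0].

(* L.+1 = k * M.+1 says L = k * M + k - 1, so rho M k is rho_k : I_L -> I_M. *)
Definition subdiv_homotopic M N (a : loop M) (b : loop N) : Prop :=
  exists k l L, [/\ 0 < k, 0 < l, L.+1 = k * M.+1, L.+1 = l * N.+1 &
    based_homotopic (fun i : 'I_L.+1 => a (rho M k i))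
                    (fun i : 'I_L.+1 => b (rho N l i))].

Definition any_loop : Type := {N : nat & loop N}.
HB.instance Definition _ := Choice.on any_loop.

Definition subdiv_rel : rel any_loop :=
  fun a b => `[< subdiv_homotopic (tagged a) (tagged b) >].

Definition const_fun : {ffun 'I_1 -> X} := [ffun=> x0].

Definition cat_fun M N (a : 'I_M.+1 -> X) (b : 'I_N.+1 -> X) :
    {ffun 'I_(M + N + 1).+1 -> X} :=
  [ffun t : 'I_(M + N + 1).+1 =>
     if t <= M then a (inord t) else b (inord (t - M.+1))].

Definition rev_fun M (a : 'I_M.+1 -> X) : {ffun 'I_M.+1 -> X} :=
  [ffun t => a (rev_ord t)].

End Loops.

(* Auxiliary to the proof of the group axioms only. A loop of length N is encoded
   as the list of its N + 1 values. By subdiv_homotopicP below, two loops are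
   subdivision-based homotopic iff their lists become homotopic after prefixing
   copies of the basepoint to both (lequiv). *)
Section ListLoops.
Variables (T : eqType) (e : rel T) (x0 : T).
Hypotheses (e_refl : reflexive e) (e_sym : symmetric e).

Definition sq : rel (T * T) := fun a b =>
  [&& e a.1 a.2, e b.1 b.2, e a.1 b.1, e a.2 b.2, e a.1 b.2 & e a.2 b.1].

Definition lp (z : seq (T * T)) : bool :=
  if z is c :: z' then [&& c == (x0, x0), path sq c z' & last c z' == (x0, x0)]
  else false.

Definition lstep (p q : seq T) : bool := (size p == size q) && lp (zip p q).

Definition lloop (p : seq T) : bool := lstep p p.

Definition lhom (p q : seq T) : Prop :=
  exists2 ps, path lstep p ps & last p ps = q.

Lemma sq00 : sq (x0, x0) (x0, x0).
Proof. by rewrite /sq /= !e_refl. Qed.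

Lemma lp_cat z1 z2 : lp z1 -> lp z2 -> lp (z1 ++ z2).
Proof.
case: z1 z2 => [|c z1] [|d z2] //= /and3P[/eqP-> p1 /eqP l1].
case/and3P=> /eqP-> p2 l2.
by rewrite eqxx /= cat_path p1 l1 /= sq00 p2 last_cat l1.
Qed.

Lemma lstep_cat p p' q q' :
  lstep p p' -> lstep q q' -> lstep (p ++ q) (p' ++ q').
Proof.
move=> /andP[/eqP s1 l1] /andP[/eqP s2 l2].
by rewrite /lstep !size_cat s1 s2 eqxx zip_cat //= lp_cat.
Qed.

Lemma sq_swap a b : sq (a.2, a.1) (b.2, b.1) = sq a b.
Proof.
by rewrite /sq /= (e_sym a.2 a.1) (e_sym b.2 b.1); do 6!case: e.
Qed.

Lemma zip_swap (p q : seq T) :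
  size p = size q -> zip q p = [seq (a.2, a.1) | a <- zip p q].
Proof. by elim: p q => [|a p IH] [|b q] //= [/IH->]. Qed.

Lemma lstep_sym p q : lstep p q -> lstep q p.
Proof.
case/andP=> /eqP spq; rewrite /lstep spq eqxx (zip_swap spq) /=.
case: (zip p q) => //= [[a b] z] /and3P[/eqP[-> ->] pz lz].
pose sw (u : T * T) := (u.2, u.1).
rewrite eqxx -[(x0, x0)]/(sw (x0, x0)) last_map (eqP lz) eqxx andbT /=.
by rewrite path_map (eq_path (e' := sq)) // => u v; apply: sq_swap.
Qed.

Lemma lstep_l p q : lstep p q -> lloop p.
Proof.
case/andP=> /eqP spq; rewrite /lloop /lstep eqxx /=.
case: p q spq => [|a p] [|b q] //= [spq] /and3P[/eqP[-> ->]].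
move=> pz /eqP lz; rewrite eqxx /=.
suff H u v : path sq (u, v) (zip p q) -> path sq (u, u) (zip p p) /\
    last (u, u) (zip p p) = ((last (u, v) (zip p q)).1, (last (u, v) (zip p q)).1).
  by have [-> ->] := H _ _ pz; rewrite lz eqxx.
elim: p q u v spq {pz lz} => [|c p IH] [|d q] u v //= [spq] /andP[/and5P[_ _ uc _ _] pz].
by have [-> ->] := IH q c d spq pz; rewrite /sq /= !e_refl uc.
Qed.

Lemma lstep_r p q : lstep p q -> lloop q.
Proof. by move/lstep_sym/lstep_l. Qed.

Lemma lhom_refl p : lhom p p.
Proof. by exists [::]. Qed.

Lemma lhom_step p q : lstep p q -> lhom p q.
Proof. by exists [:: q] => //=; rewrite andbT. Qed.

Lemma lhom_trans p q r : lhom p q -> lhom q r -> lhom p r.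
Proof.
case=> ps p1 l1 [qs p2 l2]; exists (ps ++ qs); first by rewrite cat_path p1 l1.
by rewrite last_cat l1.
Qed.

Lemma lhom_ind2 (P : seq T -> seq T -> Prop) :
  (forall p, P p p) ->
  (forall p q r, lstep p q -> lhom q r -> P q r -> P p r) ->
  forall p q, lhom p q -> P p q.
Proof.
move=> P0 PS p q [ps pp <-].
elim: ps p pp => [|r ps IH] p //= /andP[pr rps].
by apply: PS (IH _ rps) => //; exists ps.
Qed.

Lemma lhom_sym p q : lhom p q -> lhom q p.
Proof.
move: p q; apply: lhom_ind2 => [p|p q r pq _ rq]; first exact: lhom_refl.
exact/(lhom_trans rq)/lhom_step/lstep_sym.
Qed.

Lemma lhom_loop p q : lhom p q -> lloop p -> lloop q.
Proof.
by move: p q; apply: lhom_ind2 => // p q r pq _ IH _; apply/IH/(lstep_r pq).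
Qed.

Lemma lhom_size p q : lhom p q -> size p = size q.
Proof. by move: p q; apply: lhom_ind2 => // p q r /andP[/eqP-> _]. Qed.

Lemma lloop_cat p q : lloop p -> lloop q -> lloop (p ++ q).
Proof. exact: lstep_cat. Qed.

Lemma lhom_catr p q r : lloop r -> lhom p q -> lhom (p ++ r) (q ++ r).
Proof.
move=> lr; move: p q; apply: lhom_ind2 => [p|p q s pq _]; first exact: lhom_refl.
by apply: lhom_trans; apply/lhom_step/lstep_cat.
Qed.

Lemma lhom_catl p q r : lloop r -> lhom p q -> lhom (r ++ p) (r ++ q).
Proof.
move=> lr; move: p q; apply: lhom_ind2 => [p|p q s pq _]; first exact: lhom_refl.
by apply: lhom_trans; apply/lhom_step/lstep_cat.
Qed.

Lemma lhom_cat p p' q q' : lloop p' -> lloop q ->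
  lhom p p' -> lhom q q' -> lhom (p ++ q) (p' ++ q').
Proof.
move=> lp' lq pp' qq'.
exact: lhom_trans (lhom_catr lq pp') (lhom_catl lp' qq').
Qed.

Lemma lloopE p : lloop p =
  if p is a :: p' then [&& a == x0, path e a p' & last a p' == x0] else false.
Proof.
rewrite /lloop /lstep eqxx /=; case: p => [|a p] //=.
rewrite xpair_eqE andbb; congr (_ && _).
elim: p a => [|b p IH] a /=; first by rewrite xpair_eqE andbb.
rewrite -!andbA IH /sq /= !e_refl /=.
by case: (e a b).
Qed.

Definition pad i p := nseq i x0 ++ p.

Lemma pad_cat i p q : pad i (p ++ q) = pad i p ++ q.
Proof. by rewrite /pad catA. Qed.

Lemma pad_add i j p : pad i (pad j p) = pad (i + j) p.
Proof. by rewrite /pad catA nseqD. Qed.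

Lemma lloop1 : lloop [:: x0].
Proof. by rewrite lloopE /= eqxx. Qed.

Lemma pad_loop i p : lloop p -> lloop (pad i p).
Proof. by move=> lp; elim: i => //= i; apply: (lloop_cat lloop1). Qed.

Lemma pad_hom i p q : lhom p q -> lhom (pad i p) (pad i q).
Proof. by move=> pq; elim: i => //= i; apply: (lhom_catl lloop1). Qed.

Lemma dup_step s1 a b s2 : lloop (s1 ++ a :: b :: s2) ->
  lstep (s1 ++ [:: a, b, b & s2]) (s1 ++ [:: a, a, b & s2]).
Proof.
move=> h; have eab : e a b.
  move: h; rewrite lloopE; case: s1 => [|c s1] /= /and3P[_].
    by case/andP.
  by rewrite cat_path /= => /and4P[].
apply/andP; split; first by rewrite !size_cat.
move: h; rewrite /lloop /lstep eqxx /= !zip_cat //=.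
have sqaa : sq (a, a) (b, a) by rewrite /sq /= !e_refl eab (e_sym b a) eab.
have sqba : sq (b, a) (b, b) by rewrite /sq /= !e_refl eab (e_sym b a) eab.
case: s1 => [|c s1] /=; first by case/and3P=> -> /andP[_ ->] ->; rewrite sqaa sqba.
rewrite !cat_path !last_cat /= => /and3P[-> /and4P[-> -> _ ->] ->] /=.
by rewrite sqaa sqba.
Qed.

Lemma dup_loop s1 a s2 : lloop (s1 ++ a :: s2) -> lloop (s1 ++ a :: a :: s2).
Proof.
rewrite !lloopE; case: s1 => [|c s1] /=; first by rewrite e_refl.
by rewrite !cat_path !last_cat /= e_refl.
Qed.

Lemma dup_hom s1 a s2 : lloop (s1 ++ a :: s2) ->
  lhom (pad 1 (s1 ++ a :: s2)) (s1 ++ a :: a :: s2).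
Proof.
elim/last_ind: s1 a s2 => [|s1 b IH] a s2 /=.
  by rewrite lloopE => /andP[/eqP-> _]; apply: lhom_refl.
rewrite -!cats1 -!catA /= => h; apply: lhom_trans (IH b (a :: s2) h) _.
exact/lhom_step/lstep_sym/dup_step.
Qed.

Lemma dupn_hom j s1 a s2 : lloop (s1 ++ a :: s2) ->
  lhom (pad j (s1 ++ a :: s2)) (s1 ++ nseq j.+1 a ++ s2)
  /\ lloop (s1 ++ nseq j.+1 a ++ s2).
Proof.
move=> h; elim: j => [|j [IH1 IH2]]; first by split=> //; apply: lhom_refl.
split; last exact: dup_loop.
apply: lhom_trans (dup_hom IH2).
by rewrite -add1n -pad_add; apply: pad_hom.
Qed.

Definition stretch k (p : seq T) := flatten [seq nseq k a | a <- p].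

Lemma stretch_hom k s1 s2 : 0 < k -> lloop (s1 ++ s2) ->
  lhom (pad (k.-1 * size s2) (s1 ++ s2)) (s1 ++ stretch k s2).
Proof.
move=> k0; elim: s2 s1 => [|a s2 IH] s1 h; first by rewrite muln0; apply: lhom_refl.
have [h1 h2] := dupn_hom k.-1 h; rewrite prednK // catA in h1 h2.
rewrite /= mulnS addnC -pad_add; apply: lhom_trans (pad_hom _ h1) _.
by have := IH _ h2; rewrite -!catA.
Qed.

Definition lequiv p q : Prop := exists i j,
  i + size p = j + size q /\ lhom (pad i p) (pad j q).

Lemma lequiv_pad i p : lequiv (pad i p) p.
Proof.
exists 0, i; split; last exact: lhom_refl.
by rewrite /pad size_cat size_nseq.
Qed.

Lemma lequiv_hom p q : lhom p q -> lequiv p q.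
Proof. by move=> pq; exists 0, 0; rewrite (lhom_size pq). Qed.

Lemma lequiv_refl p : lequiv p p.
Proof. exact/lequiv_hom/lhom_refl. Qed.

Lemma lequiv_sym p q : lequiv p q -> lequiv q p.
Proof. by case=> i [j [ij pq]]; exists j, i; split=> //; apply: lhom_sym. Qed.

Lemma lequiv_trans p q r : lequiv p q -> lequiv q r -> lequiv p r.
Proof.
move=> [i [j [ij pq]]] [k [l [kl qr]]].
exists (k + i), (j + l); split; first by rewrite -addnA ij addnCA kl addnA.
rewrite -!pad_add; apply: lhom_trans (pad_hom k pq) _.
by rewrite pad_add addnC -pad_add; apply: pad_hom.
Qed.

Lemma pad_mid i p q : lloop p -> lloop q -> lhom (pad i (p ++ q)) (p ++ pad i q).
Proof.
move=> lp lq; case: q lq (lq) => [|a q]; first by rewrite lloopE.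
rewrite {1}lloopE => /andP[/eqP-> _] lq.
have [] := dupn_hom i (lloop_cat lp lq).
by rewrite -[i.+1]addn1 nseqD -(catA (nseq i x0)).
Qed.

Lemma lequiv_cat p p' q q' : lloop p -> lloop p' -> lloop q -> lloop q' ->
  lequiv p p' -> lequiv q q' -> lequiv (p ++ q) (p' ++ q').
Proof.
move=> lp lp' lq lq' [i [j [ij pp']]] [k [l [kl qq']]].
have mid u v r s : lloop r -> lloop s -> lequiv (r ++ s) (pad u r ++ pad v s).
  move=> lr ls; apply/lequiv_sym.
  apply: (lequiv_trans (q := pad v (pad u (r ++ s)))); last first.
    by rewrite pad_add; apply: lequiv_pad.
  apply/lequiv_hom/lhom_sym; rewrite pad_cat.
  exact/pad_mid/ls/pad_loop.
apply: lequiv_trans (mid i k _ _ lp lq) _.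
apply: lequiv_trans (lequiv_sym (mid j l _ _ lp' lq')).
by apply/lequiv_hom/lhom_cat => //; apply: pad_loop.
Qed.

Lemma lequiv1 p : lequiv (x0 :: p) p.
Proof. exact: (lequiv_pad 1). Qed.

Lemma lequiv_rcons1 p : lloop p -> lequiv (p ++ [:: x0]) p.
Proof.
case/lastP: p => [|p a lp]; first by rewrite lloopE.
have ea : a = x0.
  move: lp; rewrite lloopE -cats1; case: p => [/andP[/eqP->]|c p] //=.
  by rewrite last_cat /= => /and3P[_ _ /eqP].
rewrite ea -cats1 in lp *; rewrite -catA; apply/lequiv_sym.
apply: lequiv_trans (lequiv_sym (lequiv1 _)) _.
exact/lequiv_hom/dup_hom.
Qed.

Lemma back_step s1 a b s2 : lloop (s1 ++ [:: a, b, b, a & s2]) ->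
  lstep (s1 ++ [:: a, b, b, a & s2]) (s1 ++ [:: a, a, a, a & s2]).
Proof.
move=> h; have eab : e a b.
  move: h; rewrite lloopE; case: s1 => [|c s1] /= /and3P[_].
    by case/andP.
  by rewrite cat_path /= => /and4P[].
apply/andP; split; first by rewrite !size_cat.
move: h; rewrite /lloop /lstep eqxx /= !zip_cat //=.
have sq1 : sq (a, a) (b, a) by rewrite /sq /= !e_refl ?eab (e_sym b a) ?eab.
have sq2 : sq (b, a) (b, a) by rewrite /sq /= !e_refl ?eab (e_sym b a) ?eab.
have sq3 : sq (b, a) (a, a) by rewrite /sq /= !e_refl ?eab (e_sym b a) ?eab.
case: s1 => [|c s1] /=.
  by case/and3P=> -> /and4P[_ _ _ ->] ->; rewrite sq1 sq2 sq3.
rewrite !cat_path !last_cat /= => /and3P[-> /andP[-> /and5P[-> _ _ _ ->]] ->] /=.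
by rewrite sq1 sq2 sq3.
Qed.

Lemma lequiv_rev p : lloop (p ++ rev p) -> lequiv (p ++ rev p) [:: x0].
Proof.
elim/last_ind: p => [|s b IH]; first by rewrite lloopE.
case/lastP: s IH => [|s a] IH.
  by rewrite lloopE /= => /andP[/eqP-> _]; apply: lequiv1.
rewrite !rev_rcons -!cats1 -!catA /= in IH * => h.
have h1 := back_step h; have h2 := lstep_r h1.
have h3 : lloop (s ++ [:: a, a & rev s]).
  move: h2; rewrite !lloopE; case: (s) => [|c s'] /=; first by rewrite e_refl.
  by rewrite !cat_path !last_cat /= !e_refl.
apply: lequiv_trans (IH h3); apply: lequiv_trans (lequiv_hom (lhom_step h1)) _.
apply: lequiv_trans (lequiv_pad 2 _); apply/lequiv_hom/lhom_sym.
by have [] := dupn_hom 2 h3.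
Qed.

Lemma size_stretch k p : size (stretch k p) = k * size p.
Proof.
elim: p => [|a p IH]; first by rewrite muln0.
by rewrite size_cat -/(stretch k p) IH size_nseq mulnS.
Qed.

Lemma nth_stretch k p i : 0 < k -> i < k * size p ->
  nth x0 (stretch k p) i = nth x0 p (i %/ k).
Proof.
move=> k0; elim: p i => [|a p IH] i; first by rewrite muln0.
rewrite mulnS nth_cat size_nseq => ik; case: ltnP => [lik|kli].
  by rewrite nth_nseq lik divn_small.
rewrite IH; last by rewrite ltn_subLR.
by rewrite -{2}(subnK kli) divnDr // divnn k0 addn1.
Qed.

Lemma stretch_hom0 k p : 0 < k -> lloop p ->
  lhom (pad (k.-1 * size p) p) (stretch k p).
Proof. by move=> k0 /(stretch_hom (s1 := [::]) k0). Qed.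

Lemma lequivP p q : lloop p -> lloop q ->
  (exists k l, [/\ 0 < k, 0 < l, k * size p = l * size q &
     lhom (stretch k p) (stretch l q)]) <-> lequiv p q.
Proof.
move=> lp lq; split=> [[k [l [k0 l0 kl h]]]|[i [j [ij h]]]].
  have hp := stretch_hom0 k0 lp; have hq := stretch_hom0 l0 lq.
  apply: lequiv_trans (lequiv_sym (lequiv_pad (k.-1 * size p) p)) _.
  apply: lequiv_trans (lequiv_pad (l.-1 * size q) q).
  exact/lequiv_hom/(lhom_trans hp)/(lhom_trans h)/lhom_sym.
have p0 : 0 < size p by case: (p) lp => //; rewrite lloopE.
have q0 : 0 < size q by case: (q) lq => //; rewrite lloopE.
exists (i.+1 * size q), (i.+1 * size p).
have k0 : 0 < i.+1 * size q by rewrite muln_gt0.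
have l0 : 0 < i.+1 * size p by rewrite muln_gt0.
split=> //; first by rewrite mulnAC.
have hp := stretch_hom0 k0 lp; have hq := stretch_hom0 l0 lq.
apply: lhom_trans (lhom_sym hp) _; apply: lhom_trans hq.
set u := _.-1 * _; set v := _.-1 * _.
have uE : u + size p = i.+1 * size q * size p.
  by rewrite /u -{2}[size p]mul1n -mulnDl addn1 prednK.
have vE : v + size q = i.+1 * size q * size p.
  by rewrite /v -{2}[size q]mul1n -mulnDl addn1 prednK // mulnAC.
have iu : i <= u.
  rewrite -(leq_add2r (size p)) uE -mulnA mulSn addnC.
  by apply: leq_add; rewrite ?leq_pmulr ?leq_pmull // muln_gt0 q0.
have jv : v = u - i + j.
  apply: (can_inj (addnK (size q))); rewrite vE -uE -addnA -ij addnA subnK //.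
by rewrite jv -{1}(subnK iu) -!pad_add; apply: pad_hom.
Qed.

Lemma lstepP p q : lstep p q <->
  [/\ 0 < size p, size q = size p,
      nth x0 p 0 = x0 /\ nth x0 q 0 = x0,
      nth x0 p (size p).-1 = x0 /\ nth x0 q (size p).-1 = x0 &
      forall i, i.+1 < size p ->
        sq (nth x0 p i, nth x0 q i) (nth x0 p i.+1, nth x0 q i.+1)].
Proof.
rewrite /lstep eq_sym; split.
  case/andP=> /eqP; case: p q => [|a p] [|b q] //= spq.
  case/and3P=> /eqP[-> ->] pz /eqP lz; split=> //.
    move: lz; rewrite (last_nth (x0, x0)) -[_ :: zip p q]/(zip (x0 :: p) (x0 :: q)).
    by rewrite nth_zip ?spq // size_zip /= -(succn_inj spq) minnn => -[-> ->].
  move=> i ip; have := pathP (x0, x0) pz i; rewrite size_zip -(succn_inj spq).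
  rewrite -[_ :: zip p q]/(zip (x0 :: p) (x0 :: q)) !nth_zip //; last exact: succn_inj.
  by rewrite minnn (succn_inj spq); apply.
case=> p0 spq [p00 q00] [pn qn] H; rewrite spq eqxx /=.
case: p q p0 spq p00 q00 pn qn H => [|a p] [|b q] //= _ spq -> -> pn qn H.
rewrite eqxx /=; apply/andP; split.
  apply/(pathP (x0, x0)) => i; rewrite size_zip (succn_inj spq) minnn => ip.
  rewrite -[_ :: zip p q]/(zip (x0 :: p) (x0 :: q)) !nth_zip ?spq //; last first.
    by rewrite (succn_inj spq).
  exact: H.
rewrite (last_nth (x0, x0)) -[_ :: zip p q]/(zip (x0 :: p) (x0 :: q)).
by rewrite nth_zip ?spq // size_zip /= (succn_inj spq) minnn pn qn.
Qed.

End ListLoops.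

Section FundamentalGroup.
Variables (n : nat) (X : {fset 'rV[int]_n}) (x0 : X).

Local Notation e := (@image_adj n X).
Local Notation lhom := (lhom e x0).
Local Notation lloop := (lloop e x0).
Local Notation lstep := (lstep e x0).
Local Notation lequiv := (lequiv e x0).

Lemma image_adj_refl : reflexive e.
Proof. by move=> x; apply/forallP => i; rewrite subrr normr0. Qed.

Lemma image_adj_sym : symmetric e.
Proof. by move=> x y; apply: eq_forallb => i; rewrite distrC. Qed.

Hint Resolve image_adj_refl image_adj_sym : core.

Lemma interval_adjE N (i j : 'I_N.+1) :
  interval_adj i j = (i <= j.+1) && (j <= i.+1).
Proof. by rewrite /interval_adj; lia. Qed.

Definition tolist N (f : 'I_N.+1 -> X) : seq X :=
  mkseq (fun i => f (inord i)) N.+1.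

Lemma size_tolist N (f : 'I_N.+1 -> X) : size (tolist f) = N.+1.
Proof. exact: size_mkseq. Qed.

Lemma nth_tolist N (f : 'I_N.+1 -> X) i :
  i <= N -> nth x0 (tolist f) i = f (inord i).
Proof. by move=> iN; rewrite nth_mkseq. Qed.

Lemma inord0 N : inord 0 = ord0 :> 'I_N.+1.
Proof. by apply: val_inj; rewrite /= inordK. Qed.

Lemma inord_max N : inord N = ord_max :> 'I_N.+1.
Proof. by apply: val_inj; rewrite /= inordK. Qed.

Lemma eq_tolist N (f g : 'I_N.+1 -> X) : f =1 g -> tolist f = tolist g.
Proof. by move=> fg; apply: eq_map => i; rewrite fg. Qed.

Lemma tolistP N (f : 'I_N.+1 -> X) p : size p = N.+1 ->
  (forall i : 'I_N.+1, f i = nth x0 p i) -> tolist f = p.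
Proof.
move=> sp H; apply: (@eq_from_nth _ x0); rewrite size_tolist ?sp // => i iN.
by rewrite nth_tolist // H inordK.
Qed.

Lemma lstep_tolist N (f g : 'I_N.+1 -> X) : lstep (tolist f) (tolist g) <->
  [/\ f ord0 = x0 /\ g ord0 = x0, f ord_max = x0 /\ g ord_max = x0 &
      forall i j, interval_adj i j -> [&& e (f i) (f j), e (f i) (g j) & e (g i) (g j)]].
Proof.
split.
  case/lstepP => _ _; rewrite size_tolist -[N.+1.-1]/N.
  rewrite !nth_tolist // inord0 inord_max => h0 hN H; split=> // i j.
  have {}H k : k < N -> sq e (f (inord k), g (inord k)) (f (inord k.+1), g (inord k.+1)).
    by move=> kN; have := H k kN; rewrite !nth_tolist //; apply: ltnW.
  have C (a : 'I_N.+1) : e (f a) (g a).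
    case: (ltnP a N) => aN; first by have := H a aN; rewrite !inord_val => /and3P[].
    have -> : a = ord_max by apply: val_inj; apply/eqP; rewrite /= eqn_leq aN -ltnS ltn_ord.
    by case: hN => -> ->.
  have K (a b : 'I_N.+1) : b = a.+1 :> nat -> sq e (f a, g a) (f b, g b).
    move=> ba; have aN : a < N by rewrite -ltnS -ba.
    by have := H a aN; rewrite -ba !inord_val.
  rewrite interval_adjE => /andP[ij ji]; case: (ltngtP i j) => [lij|lji|eij].
  - have /K/and5P[_ _ /= -> -> /andP[-> _]] // : j = i.+1 :> nat.
    by apply/eqP; rewrite eqn_leq ji.
  - have /K/and5P[_ _ /= h1 h2 /andP[h3 h4]] : i = j.+1 :> nat.
      by apply/eqP; rewrite eqn_leq ij.
    by rewrite (image_adj_sym (f i)) h1 (image_adj_sym (f i)) h4 image_adj_sym.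
  - have -> : i = j by exact: val_inj.
    by rewrite C !image_adj_refl.
case=> h0 hN H; apply/lstepP.
rewrite !size_tolist -[N.+1.-1]/N !nth_tolist // inord0 inord_max; split=> // i iN.
have iN' : i <= N by exact: ltnW.
rewrite !nth_tolist //.
have A : interval_adj (inord i : 'I_N.+1) (inord i.+1).
  by rewrite interval_adjE !inordK ?leqnn ?andbT //; apply: ltnW.
have B : interval_adj (inord i.+1 : 'I_N.+1) (inord i).
  by move: A; rewrite !interval_adjE andbC.
have /and3P[h1 h2 h3] := H _ _ A; have /and3P[_ h4 _] := H _ _ B.
have D (a : 'I_N.+1) : e (f a) (g a).
  have aa : interval_adj a a by rewrite interval_adjE !leqnSn.
  by have /and3P[] := H a a aa.
by rewrite /sq /= !D h1 h2 h3 image_adj_sym.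
Qed.

Lemma is_based_loopP N (f : {ffun 'I_N.+1 -> X}) :
  is_based_loop x0 f <-> lloop (tolist f).
Proof.
split.
  case/and3P=> /'forall_forallP H /eqP h0 /eqP hN.
  by apply/lstep_tolist; split=> // i j /(implyP (H i j)) ->.
case/lstep_tolist => [[h0 _] [hN _] H].
rewrite /is_based_loop h0 hN eqxx !andbT.
by apply/'forall_forallP => i j; apply/implyP => /H/and3P[].
Qed.

Lemma loopP N (a : loop x0 N) : lloop (tolist a).
Proof. exact/is_based_loopP/(valP a). Qed.

Lemma based_homotopicP M (f g : 'I_M.+1 -> X) :
  lloop (tolist f) -> based_homotopic x0 f g <-> lhom (tolist f) (tolist g).
Proof.
move=> lf; split.
  case=> R [R0 [H [/'forall_forallP Hc H0 HM]]].
  pose h t := tolist (fun s => H (s, inord t)).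
  have -> : tolist f = h 0.
    by apply: eq_tolist => s; rewrite inord0; case: (H0 s).
  have -> : tolist g = h R.
    by apply: eq_tolist => s; rewrite inord_max; case: (H0 s).
  have step t : t < R -> lstep (h t) (h t.+1).
    move=> tR; apply/lstep_tolist; split.
    - by split; case: (HM (inord t)); case: (HM (inord t.+1)).
    - by split; case: (HM (inord t)); case: (HM (inord t.+1)).
    move=> i j ij.
    have A u v : interval_adj u v -> e (H (i, u)) (H (j, v)).
      by move=> uv; apply: (implyP (Hc (i, u) (j, v))); rewrite /prod_adj ij.
    by rewrite !A // interval_adjE ?leqnSn // !inordK ?leqnn ?andbT // ltnW // ltnW.
  elim: {-2}R (leqnn R) => [|t IH] tR; first exact: lhom_refl.
  exact: lhom_trans (IH (ltnW tR)) (lhom_step (step _ tR)).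
case=> ps pp lps; pose qs := rcons ps (tolist g).
have lg : lloop (tolist g) by apply: lhom_loop lf => //; exists ps.
have pq : path lstep (tolist f) qs by rewrite /qs rcons_path pp lps.
pose h t := nth [::] (tolist f :: qs) t.
have hs t : t < size qs -> lstep (h t) (h t.+1).
  by move=> tq; have := pathP [::] pq t tq.
have hR : h (size qs) = tolist g by rewrite /h /qs size_rcons /= nth_rcons ltnn eqxx.
exists (size qs); rewrite {1}size_rcons; split=> //.
pose H (u : 'I_M.+1 * 'I_(size qs).+1) := nth x0 (h u.2) u.1.
have hl t : t <= size qs -> lloop (h t).
  rewrite leq_eqVlt => /orP[/eqP->|/hs/lstep_l]; last exact.
  by rewrite hR.
have hz t : t <= size qs -> size (h t) = M.+1.
  elim: t => [|t IH] tq; first exact: size_tolist.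
  by rewrite -IH; [case/andP: (hs _ tq) => /eqP-> | apply: ltnW].
have hT (t : 'I_(size qs).+1) : tolist (fun s => H (s, t)) = h t.
  by apply: tolistP => //; rewrite hz // -ltnS.
exists H; split.
- apply/'forall_forallP => -[i u] [j v]; apply/implyP => /andP[/= ij].
  have C (a b : 'I_(size qs).+1) (k l : 'I_M.+1) :
      b = a.+1 :> nat -> interval_adj k l -> e (H (k, a)) (H (l, b)).
    move=> ba kl; have aq : a < size qs by rewrite -ltnS -ba.
    have := hs _ aq; rewrite -ba -!hT => /lstep_tolist[_ _ /(_ _ _ kl)].
    by case/and3P.
  rewrite interval_adjE => /andP[uv vu]; case: (ltngtP u v) => [luv|lvu|euv].
  + by apply: C => //; apply/eqP; rewrite eqn_leq vu.
  + rewrite image_adj_sym; apply: C; first by apply/eqP; rewrite eqn_leq uv.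
    by move: ij; rewrite !interval_adjE andbC.
  + have -> : u = v by apply: val_inj.
    have := hl v; rewrite -ltnS ltn_ord -hT => /(_ isT)/lstep_tolist[_ _ /(_ _ _ ij)].
    by case/and3P.
- move=> s; have sM : s <= M by rewrite -ltnS.
  by rewrite /H /= hR -[h 0]/(tolist f) !nth_tolist // inord_val.
- move=> t; have := hl t; rewrite -ltnS ltn_ord -hT.
  by case/(_ isT)/lstep_tolist => [[-> _] [-> _] _].
Qed.

Lemma tolist_rho L N k (f : 'I_N.+1 -> X) : L.+1 = k * N.+1 ->
  tolist (fun i : 'I_L.+1 => f (rho N k i)) = stretch k (tolist f).
Proof.
move=> Lk; have k0 : 0 < k by case: k Lk.
apply: tolistP; first by rewrite size_stretch size_tolist.
move=> i; rewrite nth_stretch // ?size_tolist -?Lk ?ltn_ord //.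
by rewrite nth_tolist // -ltnS ltn_divLR // mulnC -Lk.
Qed.

Lemma subdiv_homotopicP M N (a : loop x0 M) (b : loop x0 N) :
  subdiv_homotopic a b <-> lequiv (tolist a) (tolist b).
Proof.
have la := loopP a; have lb := loopP b.
have str k (p : seq X) : 0 < k -> lloop p -> lloop (stretch k p).
  move=> k0 lp; apply: lhom_loop (stretch_hom0 _ _ k0 lp) _ => //.
  exact: pad_loop.
have hom k l L : 0 < k -> L.+1 = k * M.+1 -> L.+1 = l * N.+1 ->
    based_homotopic x0 (fun i : 'I_L.+1 => a (rho M k i))
                       (fun i : 'I_L.+1 => b (rho N l i)) <->
    lhom (stretch k (tolist a)) (stretch l (tolist b)).
  move=> k0 Lk Ll; rewrite based_homotopicP ?tolist_rho //; exact: str.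
split.
  case=> k [l [L [k0 l0 Lk Ll h]]]; apply/lequivP => //; exists k, l.
  by rewrite !size_tolist -Lk -Ll; split=> //; apply/(hom k l L).
case/lequivP=> // k [l [k0 l0]]; rewrite !size_tolist => kl h.
have kM : (k * M.+1).-1.+1 = k * M.+1 by rewrite prednK // muln_gt0 k0.
exists k, l, (k * M.+1).-1; split; rewrite ?kM //.
by apply/hom; rewrite ?kM.
Qed.

Lemma subdiv_rel_refl : reflexive (@subdiv_rel n X x0).
Proof. by move=> a; apply/asboolP/subdiv_homotopicP/lequiv_refl. Qed.

Lemma subdiv_rel_sym : symmetric (@subdiv_rel n X x0).
Proof.
by move=> a b; apply/asboolP/asboolP => /subdiv_homotopicP h;
  apply/subdiv_homotopicP/lequiv_sym.
Qed.

Lemma subdiv_rel_trans : transitive (@subdiv_rel n X x0).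
Proof.
move=> b a c /asboolP/subdiv_homotopicP h1 /asboolP/subdiv_homotopicP h2.
apply/asboolP/subdiv_homotopicP; exact: lequiv_trans h1 h2.
Qed.

Canonical subdiv_equiv_rel :=
  EquivRel (@subdiv_rel n X x0) subdiv_rel_refl subdiv_rel_sym subdiv_rel_trans.

Lemma tolist_cat M N (f : 'I_M.+1 -> X) (g : 'I_N.+1 -> X) :
  tolist (cat_fun f g) = tolist f ++ tolist g.
Proof.
apply: tolistP; first by rewrite size_cat !size_tolist; lia.
move=> i; rewrite nth_cat size_tolist ffunE ltnS.
case: leqP => iM; first by rewrite nth_tolist.
by rewrite nth_tolist //; have := ltn_ord i; lia.
Qed.

Lemma tolist_rev M (f : 'I_M.+1 -> X) : tolist (rev_fun f) = rev (tolist f).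
Proof.
apply: tolistP; first by rewrite size_rev size_tolist.
move=> i; rewrite nth_rev size_tolist // ffunE nth_tolist; last by lia.
by congr f; apply: val_inj; rewrite /= inordK //; lia.
Qed.

Lemma tolist_const : tolist (const_fun x0) = [:: x0].
Proof. by rewrite /tolist /mkseq /= ffunE. Qed.

Lemma lloop_rev p : lloop p -> lloop (rev p).
Proof.
rewrite !lloopE //; case: p => [|a p] // /and3P[/eqP-> pp /eqP lp].
case/lastP: p lp pp => [|p b]; first by rewrite /rev /= eqxx.
rewrite last_rcons -rcons_cons => -> pp; rewrite rev_rcons eqxx /=.
rewrite rev_cons last_rcons eqxx andbT.
have := rev_path e x0 (rcons p x0); rewrite last_rcons belast_rcons rev_cons => ->.
by rewrite (eq_path (e' := e)) // => u v; apply: image_adj_sym.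
Qed.

Lemma const_fun_loop : is_based_loop x0 (const_fun x0).
Proof. by apply/is_based_loopP; rewrite tolist_const; apply: lloop1. Qed.

Lemma cat_fun_loop M N (a : loop x0 M) (b : loop x0 N) :
  is_based_loop x0 (cat_fun a b).
Proof.
apply/is_based_loopP; rewrite tolist_cat.
by apply: lloop_cat => //; apply: loopP.
Qed.

Lemma rev_fun_loop M (a : loop x0 M) : is_based_loop x0 (rev_fun a).
Proof. by apply/is_based_loopP; rewrite tolist_rev; apply/lloop_rev/loopP. Qed.

Definition mk_loop N f (fP : is_based_loop x0 f) : loop x0 N := exist _ f fP.

Definition const_loop : any_loop x0 :=
  Tagged (loop x0) (mk_loop const_fun_loop).

Definition cat_loop (a b : any_loop x0) : any_loop x0 :=
  Tagged (loop x0) (mk_loop (cat_fun_loop (tagged a) (tagged b))).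

Definition rev_loop (a : any_loop x0) : any_loop x0 :=
  Tagged (loop x0) (mk_loop (rev_fun_loop (tagged a))).

Definition pi1 : Type := {eq_quot subdiv_equiv_rel}%qT.
HB.instance Definition _ := Choice.on pi1.

Definition pi1_class (a : any_loop x0) : pi1 :=
  (\pi_{eq_quot subdiv_equiv_rel} a)%qT.
Definition pi1_repr (x : pi1) : any_loop x0 :=
  repr (x : {eq_quot subdiv_equiv_rel}%qT).

Definition pi1_one : pi1 := pi1_class const_loop.
Definition pi1_mul (x y : pi1) : pi1 :=
  pi1_class (cat_loop (pi1_repr x) (pi1_repr y)).
Definition pi1_inv (x : pi1) : pi1 := pi1_class (rev_loop (pi1_repr x)).

Lemma pi1_classP a b :
  pi1_class a = pi1_class b <-> subdiv_homotopic (tagged a) (tagged b).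
Proof. by split=> [/eqmodP/asboolP // | ab]; apply/eqmodP/asboolP. Qed.

Definition anylist (a : any_loop x0) : seq X := tolist (tagged a).

Lemma pi1_classE a b : pi1_class a = pi1_class b <-> lequiv (anylist a) (anylist b).
Proof. by rewrite pi1_classP subdiv_homotopicP. Qed.

Lemma anyloopP a : lloop (anylist a).
Proof. exact: loopP. Qed.

Lemma anylist_cat a b : anylist (cat_loop a b) = anylist a ++ anylist b.
Proof. exact: tolist_cat. Qed.

Lemma anylist_rev a : anylist (rev_loop a) = rev (anylist a).
Proof. exact: tolist_rev. Qed.

Lemma anylist_const : anylist const_loop = [:: x0].
Proof. exact: tolist_const. Qed.

Lemma pi1_reprK : cancel pi1_repr pi1_class.
Proof. by move=> x; apply: reprK. Qed.

Lemma pi1_repr_class a : lequiv (anylist (pi1_repr (pi1_class a))) (anylist a).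
Proof. by apply/pi1_classE; rewrite pi1_reprK. Qed.

Lemma pi1_mulE a b : pi1_mul (pi1_class a) (pi1_class b) = pi1_class (cat_loop a b).
Proof.
apply/pi1_classE; rewrite !anylist_cat.
by apply: lequiv_cat => //; first [exact: anyloopP | exact: pi1_repr_class].
Qed.

Lemma pi1_mulA : associative pi1_mul.
Proof.
move=> x y z; rewrite -(pi1_reprK x) -(pi1_reprK y) -(pi1_reprK z) !pi1_mulE.
by apply/pi1_classE; rewrite !anylist_cat catA; apply: lequiv_refl.
Qed.

Lemma pi1_mul1 : left_id pi1_one pi1_mul.
Proof.
move=> x; rewrite -(pi1_reprK x) pi1_mulE; apply/pi1_classE.
by rewrite anylist_cat anylist_const; apply: lequiv1.
Qed.

Lemma pi1_mulr1 : right_id pi1_one pi1_mul.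
Proof.
move=> x; rewrite -(pi1_reprK x) pi1_mulE; apply/pi1_classE.
by rewrite anylist_cat anylist_const; apply: lequiv_rcons1 => //; apply: anyloopP.
Qed.

Lemma pi1_mulrV : right_inverse pi1_one pi1_inv pi1_mul.
Proof.
move=> x; rewrite -{1}(pi1_reprK x) pi1_mulE; apply/pi1_classE.
rewrite anylist_cat anylist_rev anylist_const; apply: lequiv_rev => //.
by apply: lloop_cat => //; [|apply: lloop_rev]; apply: anyloopP.
Qed.

Lemma pi1_mulV : left_inverse pi1_one pi1_inv pi1_mul.
Proof.
move=> x; rewrite -{2}(pi1_reprK x) pi1_mulE; apply/pi1_classE.
rewrite anylist_cat anylist_rev anylist_const -{2}[anylist _]revK.
apply: lequiv_rev => //; rewrite revK.
by apply: lloop_cat => //; [apply: lloop_rev|]; apply: anyloopP.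
Qed.

HB.instance Definition _ := isGroup.Build pi1
  pi1_mulA pi1_mul1 pi1_mulr1 pi1_mulV pi1_mulrV.

End FundamentalGroup.

(* Main.v *)
Require Import Defs.
From HB Require Import structures.
From mathcomp Require Import all_boot all_order all_algebra.
From mathcomp Require Import finmap.
From mathcomp Require Import boolp zify.

Set Implicit Arguments.
Unset Strict Implicit.
Unset Printing Implicit Defensive.

(** Only the adjacency graph of a digital image matters for its fundamental
group, and every finite graph is the adjacency graph of some image
(graph_point_adj).  So the task is to build, from a finite presentation, a
finite graph with the right group of loops.  A homotopy of loops moves all
vertices at once, but each of its cells is a clique, so it decomposes into two
local moves, dropping a repeated vertex and cutting the corner of a triangle
(the relation htpy): the fundamental group is the edge-path group of the clique
complex of the graph.

The graph is a triangulated presentation complex, with one twist: it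
must be a graph without double edges, and every triangle of that graph is
filled.  The generators come from a theta graph, two vertices joined by k + 1
arcs of length two; being bipartite it has no triangles, and going out along
the i-th arc and back along the distinguished one gives the i-th generator.
Each relator r is then killed by a disc glued along the loop that spells r: a
ring of vertices, one for each position of the loop, each adjacent to the loop
at that position and at the next, and a centre adjacent to the whole ring.  A
vertex of the ring is adjacent to the loop at two consecutive positions only, so
the triangles of the disc stay consistent in the sense below even where the loop
passes several times through the same vertex or backtracks.

That the group is the presented one follows from two structures carried along
the construction.  Edges are labelled by words so that the labels of every
triangle multiply correctly in the presented group (cocycle); the product of
the labels along a loop is then invariant under homotopy (htpy_spell,
lequiv_spell) and defines a homomorphism from the fundamental group, the
holonomy.  It is onto because each generator is spelled by a loop.  It is
injective because of a combing: a path from the base point to each vertex, such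
that following an edge u - v after the path to u amounts to a product of
generator loops, spelled by the label of the edge, followed by the path to v.
By induction every loop is homotopic to the product of generator loops that
spells its own label (comb_walk); if the label is trivial in the presented
group, that product is trivial since relators bound discs (word_loop_equiv). *)

(** * Walks and homotopies in a reflexive graph *)

Section Walks.
Variables (V : eqType) (e : rel V).

Definition walk (u : V) (p : seq V) (v : V) : bool :=
  if p is a :: q then [&& a == u, path e a q & last a q == v] else false.

(** The edge-path relation of the clique complex.  It is defined on all vertex
lists; it preserves endpoints and adjacency of consecutive vertices, so walks
are only ever related to walks (htpy_walk). *)
Inductive htpy : seq V -> seq V -> Prop :=
| HtpyRefl p : htpy p p
| HtpySym p q : htpy p q -> htpy q p
| HtpyTrans p q r : htpy p q -> htpy q r -> htpy p r
| HtpyStutter s a t : htpy (s ++ a :: a :: t) (s ++ a :: t)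
| HtpyTriangle s a b c t : e a b -> e b c -> e a c ->
    htpy (s ++ a :: b :: c :: t) (s ++ a :: c :: t).

Lemma htpy_ctx s t p q : htpy p q -> htpy (s ++ p ++ t) (s ++ q ++ t).
Proof.
elim=> {p q} [p|p q _|p q r _ pq _ qr|u a v|u a b c v ab bc ac].
- exact: HtpyRefl.
- exact: HtpySym.
- exact: HtpyTrans pq qr.
- rewrite -!catA !(catA s u); exact: HtpyStutter.
- rewrite -!catA !(catA s u); exact: HtpyTriangle.
Qed.

Lemma htpy_catl s p q : htpy p q -> htpy (s ++ p) (s ++ q).
Proof. by move=> /(htpy_ctx s [::]); rewrite !cats0. Qed.

Lemma htpy_catr t p q : htpy p q -> htpy (p ++ t) (q ++ t).
Proof. exact: (htpy_ctx [::]). Qed.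

Lemma htpy_walk u v p q : reflexive e -> htpy p q -> walk u p v = walk u q v.
Proof.
move=> e_refl; elim=> {p q} [p|p q _ ->|p q r _ -> _ ->|s a t|s a b c t ab bc ac] //.
  by case: s => [|d s] /=; rewrite ?cat_path ?last_cat /= e_refl.
by case: s => [|d s] /=; rewrite ?cat_path ?last_cat /= ab bc ac.
Qed.

(** Walks are composed by plain concatenation: the shared endpoint is then
repeated, which is harmless up to homotopy and keeps both factors intact. *)
Lemma walk_cat u v w p q : reflexive e ->
  walk u p v -> walk v q w -> walk u (p ++ q) w.
Proof.
move=> e_refl; case: p q => [|a p] [|b q] //=.
move=> /and3P[-> pp /eqP lp] /and3P[/eqP-> pq lq].
by rewrite cat_path last_cat pp lp /= e_refl pq lq.
Qed.

Lemma walk_rcons u v w p : walk u p v -> e v w -> walk u (rcons p w) w.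
Proof.
case: p => [|a p] //= /and3P[-> pp /eqP lp] vw.
by rewrite rcons_path last_rcons pp lp vw eqxx.
Qed.

Lemma walk_rev u v p : symmetric e -> walk u p v -> walk v (rev p) u.
Proof.
move=> e_sym; elim: p u => [|a [|b p] IH] u //.
  by move=> /and3P[/eqP-> _ /eqP<-]; rewrite /= !eqxx.
move=> /and3P[/eqP-> /= /andP[ab pp] lp].
rewrite rev_cons; apply: (walk_rcons (v := b)); last by rewrite e_sym.
by apply: IH; rewrite /= eqxx pp.
Qed.

(** Past its end, the walk is regarded as resting at its last vertex. *)
Lemma walk_nth u v p j : reflexive e -> walk u p v -> e (nth v p j) (nth v p j.+1).
Proof.
move=> e_refl; elim: p u j => [|a [|b p] IH] u j //.
  by move=> /and3P[_ _ /= /eqP->]; case: j => [|j] /=; rewrite ?nth_nil.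
move=> /and3P[_ /= /andP[ab pp] lp]; case: j => [|j] //=.
by apply: (IH b); rewrite /= eqxx pp.
Qed.

Lemma htpy_backtrack s a b t : reflexive e -> symmetric e -> e a b ->
  htpy (s ++ a :: b :: a :: t) (s ++ a :: t).
Proof.
move=> e_refl e_sym ab; apply: HtpyTrans (HtpyStutter s a t).
by apply: HtpyTriangle => //; rewrite e_sym.
Qed.

(** The base vertex after the round trip makes the right-hand side a
nonempty walk whatever follows it, so that the lemma applies inside a product. *)
Lemma htpy_rev u v p s : reflexive e -> symmetric e -> walk u p v ->
  htpy (p ++ rev p ++ u :: s) (u :: s).
Proof.
move=> e_refl e_sym; elim: p u s => [|a [|b p] IH] u s //.
  move=> /and3P[/eqP-> _ _] /=; apply: HtpyTrans (HtpyStutter [::] u s).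
  exact: (HtpyStutter [:: u]).
move=> /and3P[/eqP-> /= /andP[ub pp] lp].
rewrite rev_cons -cats1 -catA /=.
apply: HtpyTrans (HtpyStutter [::] u s).
apply: HtpyTrans (htpy_backtrack [::] (u :: s) e_refl e_sym ub).
have wb : walk b (b :: p) v by rewrite /= eqxx pp.
apply: (@htpy_catl [:: u] (b :: p ++ _) (b :: u :: u :: s)).
have ubu : htpy (rev (b :: p) ++ u :: u :: s) (rev (b :: p) ++ b :: u :: u :: s).
  rewrite rev_cons -cats1 -!catA; apply: HtpySym; exact: (HtpyStutter (rev p) b).
exact: HtpyTrans (htpy_catl (b :: p) ubu) (IH b (u :: u :: s) wb).
Qed.

End Walks.

Lemma htpy_map (V W : eqType) (e : rel V) (e' : rel W) (f : V -> W) p q :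
  (forall u v, e u v -> e' (f u) (f v)) ->
  htpy e p q -> htpy e' (map f p) (map f q).
Proof.
move=> ef; elim=> {p q} [p|p q _|p q r _ pq _ qr|s a t|s a b c t ab bc ac].
- exact: HtpyRefl.
- exact: HtpySym.
- exact: HtpyTrans pq qr.
- rewrite !map_cat /=; exact: HtpyStutter.
- rewrite !map_cat /=; apply: HtpyTriangle; exact: ef.
Qed.

(** * Homotopy of loops and edge-path homotopy *)

Section LoopLists.
Variables (V : eqType) (e : rel V) (x0 : V).
Hypotheses (e_refl : reflexive e) (e_sym : symmetric e).

Lemma lloop_walk p : lloop e x0 p = walk e x0 p x0.
Proof. exact: lloopE. Qed.

(** The corner b is produced by moving one of two copies of a, so a single time
step is enough. *)
Lemma triangle_step s a b c t : e a b -> e b c -> e a c ->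
  lloop e x0 (s ++ a :: c :: t) ->
  lstep e x0 (s ++ [:: a, a, c & t]) (s ++ [:: a, b, c & t]).
Proof.
move=> ab bc ac h; apply/andP; split; first by rewrite !size_cat.
move: h; rewrite /lloop /lstep eqxx /= !zip_cat //=.
have sq1 : sq e (a, a) (a, b) by rewrite /sq /= !e_refl ab.
have sq2 : sq e (a, b) (c, c) by rewrite /sq /= e_refl ab bc ac.
case: s => [|d s] /=; first by case/and3P=> -> /andP[_ ->] ->; rewrite sq1 sq2.
rewrite !cat_path !last_cat /= => /and3P[-> /and4P[-> -> _ ->] ->] /=.
by rewrite sq1 sq2.
Qed.

(** A move changes the length of a loop, and is thus compensated by one
stationary step at the base point, which can be transported to the place of
the move (dup_hom). *)
Lemma htpy_lequiv p q : htpy e p q -> walk e x0 p x0 -> lequiv e x0 p q.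
Proof.
elim=> {p q} [p|p q pq IH|p q r pq IH1 qr IH2|s a t|s a b c t ab bc ac] wp.
- exact: lequiv_refl.
- by apply/lequiv_sym/IH => //; rewrite (htpy_walk _ _ e_refl pq).
- have wq : walk e x0 q x0 by rewrite -(htpy_walk x0 x0 e_refl pq).
  exact: lequiv_trans (IH1 wp) (IH2 wq).
- apply: (lequiv_trans e_refl _ (lequiv_pad e x0 1 _)); apply: (lequiv_sym e_sym).
  apply: lequiv_hom.
  apply: dup_hom => //.
  by rewrite lloop_walk -(htpy_walk _ _ e_refl (HtpyStutter e s a t)).
- apply: (lequiv_trans e_refl _ (lequiv_pad e x0 1 _)); apply: (lequiv_sym e_sym).
  apply: lequiv_hom.
  have lq : lloop e x0 (s ++ a :: c :: t).
    by rewrite lloop_walk -(htpy_walk _ _ e_refl (HtpyTriangle s t ab bc ac)).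
  apply: lhom_trans (dup_hom e_refl e_sym lq) _.
  exact/lhom_step/triangle_step.
Qed.

End LoopLists.

Lemma lequiv_map (V W : eqType) (e : rel V) (e' : rel W) (f : V -> W) x0 p q :
  (forall u v, e u v -> e' (f u) (f v)) ->
  lequiv e x0 p q -> lequiv e' (f x0) (map f p) (map f q).
Proof.
move=> ef [i [j [ij [ps pps lps]]]].
exists i, j; rewrite !size_map; split=> //.
have step s t : lstep e x0 s t -> lstep e' (f x0) (map f s) (map f t).
  case/andP=> /eqP st; rewrite /lstep !size_map st eqxx /=.
  pose g (a : V * V) := (f a.1, f a.2).
  have -> : zip (map f s) (map f t) = map g (zip s t).
    by elim: s t st => [|a s IH] [|b t] //= [/IH ->].
  case: (zip s t) => [|a z] //= /and3P[/eqP-> pz /eqP lz].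
  rewrite -[(f x0, f x0)]/(g (x0, x0)) !eqxx last_map lz eqxx andbT /=.
  rewrite path_map; apply: sub_path pz => c d.
  by rewrite /sq /= => /and5P[h1 h2 h3 h4 /andP[h5 h6]]; rewrite !ef.
have padE m s : pad (f x0) m (map f s) = map f (pad x0 m s).
  by rewrite /pad map_cat map_nseq.
exists (map (map f) ps); last by rewrite padE last_map lps padE.
rewrite padE path_map; exact: sub_path pps.
Qed.

(** * Words spelled by walks *)

Lemma pres_class_cat k (R : seq (word k)) u v :
  pres_class R (u ++ v) = (pres_class R u * pres_class R v)%g.
Proof. exact/esym/pres_mulE. Qed.

Lemma pres_class_winv k (R : seq (word k)) u :
  pres_class R (winv u) = ((pres_class R u)^-1)%g.
Proof. exact/esym/pres_invE. Qed.

Lemma pres_class_nil k (R : seq (word k)) : pres_class R [::] = 1%g.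
Proof. by []. Qed.

Section Spell.
Variables (k : nat) (V : eqType) (lab : V -> V -> word k).

Definition spell (p : seq V) : word k :=
  if p is a :: q then flatten (pairmap lab a q) else [::].

Lemma spell_cons a b p : spell [:: a, b & p] = lab a b ++ spell (b :: p).
Proof. by []. Qed.

(** The cut vertex belongs to both halves: labels live on edges. *)
Lemma spell_cut s a t : spell (s ++ a :: t) = spell (rcons s a) ++ spell (a :: t).
Proof.
case: s => [|b s] //=.
by rewrite pairmap_cat flatten_cat /= -cats1 pairmap_cat flatten_cat /= cats0 catA.
Qed.

Lemma spell_rcons a p b :
  spell (rcons (a :: p) b) = spell (a :: p) ++ lab (last a p) b.
Proof. by rewrite /= -cats1 pairmap_cat flatten_cat /= cats0. Qed.

End Spell.

Lemma spell_map k (V W : eqType) (lab : V -> V -> word k) (lab' : W -> W -> word k)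
    (f : V -> W) p :
  (forall u v, lab' (f u) (f v) = lab u v) -> spell lab' (map f p) = spell lab p.
Proof.
by move=> fl; case: p => //= a p; elim: p a => //= b p IH a; rewrite fl IH.
Qed.

Section Cocycle.
Variables (k : nat) (R : seq (word k)) (V : eqType) (e : rel V).
Variables (lab : V -> V -> word k).
Hypothesis e_refl : reflexive e.
Local Notation cl := (pres_class R).
Local Notation spell := (spell lab).
Local Open Scope group_scope.

Definition cocycle : Prop := forall u v w, e u v -> e v w -> e u w ->
  cl (lab u v) * cl (lab v w) = cl (lab u w).

Hypothesis labC : cocycle.

Lemma lab_refl u : cl (lab u u) = 1.
Proof. by apply: (mulgI (cl (lab u u))); rewrite mulg1 labC. Qed.

Lemma htpy_spell p q : htpy e p q -> cl (spell p) = cl (spell q).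
Proof.
elim=> {p q} [p|p q _ ->|p q r _ -> _ ->|s a t|s a b c t ab bc ac] //.
  by rewrite !(spell_cut _ s a) spell_cons !pres_class_cat lab_refl mul1g.
rewrite !(spell_cut _ s a) !spell_cons !pres_class_cat; congr (_ * _).
by rewrite mulgA labC.
Qed.

(** One time step of a homotopy is a ladder whose squares are cliques.  Pushing
the label of a rung across one square at a time moves it from the right end to
the left one. *)
Lemma ladder_spell a b p q : size p = size q -> e a b ->
  path (sq e) (a, b) (zip p q) ->
  cl (spell (a :: p)) * cl (lab (last a p) (last b q)) =
  cl (lab a b) * cl (spell (b :: q)).
Proof.
elim: p q a b => [|c p IH] [|d q] a b //=.
  by rewrite !pres_class_nil mul1g mulg1.
move=> [spq] ab /andP[/and5P[_ /= cd ac bd /andP[ad _]] pz].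
rewrite -!/(spell (_ :: _)) !pres_class_cat -mulgA IH // mulgA labC //.
by rewrite -(labC ab bd ad) mulgA.
Qed.

Variable x0 : V.

Lemma lstep_spell p q : lstep e x0 p q -> cl (spell p) = cl (spell q).
Proof.
case/andP=> /eqP; case: p q => [|a p] [|b q] // [spq] /= /and3P[/eqP[-> ->] pz].
have lastE c d : last (c, d) (zip p q) = (last c p, last d q).
  elim: p q c d spq {pz} => [|c' p IH] [|d' q] c d //= [spq]; exact: IH.
have := ladder_spell spq (e_refl x0) pz.
rewrite lastE xpair_eqE => sE /andP[/eqP lp /eqP lq].
by move: sE; rewrite lp lq lab_refl mulg1 mul1g.
Qed.

Lemma lequiv_spell p q : walk e x0 p x0 -> walk e x0 q x0 ->
  lequiv e x0 p q -> cl (spell p) = cl (spell q).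
Proof.
have padE i s : walk e x0 s x0 -> cl (spell (pad x0 i s)) = cl (spell s).
  case: s => //= a s /and3P[/eqP-> _ _].
  by elim: i => [|[|i] IH] //; rewrite -{}IH /= pres_class_cat lab_refl mul1g.
move=> wp wq [i [j [_ [ps pps lps]]]]; rewrite -(padE i p wp) -(padE j q wq) -{}lps.
elim: ps (pad x0 i p) pps => //= r ps IH s /andP[sr pps].
by rewrite (lstep_spell sr) IH.
Qed.

End Cocycle.

Section CocycleWalks.
Variables (k : nat) (R : seq (word k)) (V : eqType) (e : rel V).
Variables (lab : V -> V -> word k).
Hypotheses (e_refl : reflexive e) (e_sym : symmetric e) (labC : cocycle R e lab).
Local Notation cl := (pres_class R).
Local Notation spell := (spell lab).
Local Open Scope group_scope.

Lemma spell_cat u v w p q : walk e u p v -> walk e v q w ->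
  cl (spell (p ++ q)) = cl (spell p) * cl (spell q).
Proof.
case: p q => [|a p] [|b q] // /and3P[_ _ /eqP lp] /and3P[/eqP-> _ _].
rewrite spell_cut rcons_cons -rcons_cons spell_rcons lp !pres_class_cat.
by rewrite (lab_refl e_refl labC) mulg1.
Qed.

Lemma spell_rev u v p : walk e u p v -> cl (spell (rev p)) = (cl (spell p))^-1.
Proof.
move=> wp; have wr := walk_rev e_sym wp.
have w1 : walk e u [:: u] u by rewrite /= !eqxx.
apply: (mulgI (cl (spell p))); rewrite mulgV.
have := htpy_spell e_refl labC (htpy_rev [::] e_refl e_sym wp).
by rewrite (spell_cat wp (walk_cat e_refl wr w1)) (spell_cat wr w1) /= mulg1.
Qed.

End CocycleWalks.

(** * Combings *)

Section Combing.
Variables (k : nat) (R : seq (word k)) (V : eqType) (e : rel V) (x0 : V).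
Variables (lab : V -> V -> word k) (gen : 'I_k -> seq V) (tail : V -> seq V).
Local Notation cl := (pres_class R).
Local Notation spell := (spell lab).

Definition letter_loop (a : 'I_k * bool) : seq V :=
  if a.2 then gen a.1 else rev (gen a.1).

Definition word_loop (w : word k) : seq V := flatten (map letter_loop w).

Lemma word_loop_cat u v : word_loop (u ++ v) = word_loop u ++ word_loop v.
Proof. by rewrite /word_loop map_cat flatten_cat. Qed.

Lemma word_loop_cons a w : word_loop (a :: w) = letter_loop a ++ word_loop w.
Proof. by []. Qed.

(** The path from x0 to a vertex v is x0 :: tail v, so it is nonempty by
construction.  The last field is the whole content: appending the edge u - v to
the path to u gives the path to v up to the generator loops that the label of
the edge spells. *)
Record combing : Prop := Combing {
  comb_refl : reflexive e;
  comb_sym : symmetric e;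
  comb_cocycle : cocycle R e lab;
  comb_gen : forall i, walk e x0 (gen i) x0;
  comb_label : forall i, cl (spell (gen i)) = cl [:: (i, true)];
  comb_base : tail x0 = [::];
  comb_edge : forall u v, e u v ->
    htpy e (x0 :: rcons (tail u) v) (word_loop (lab u v) ++ x0 :: tail v)
}.

Hypothesis cb : combing.
Let e_refl := comb_refl cb.
Let e_sym := comb_sym cb.
Let labC := comb_cocycle cb.

Lemma letter_loop_walk a : walk e x0 (letter_loop a) x0.
Proof.
case: a => i [] /=; first exact: (comb_gen cb).
exact/(walk_rev e_sym)/(comb_gen cb).
Qed.

Lemma walk1 : walk e x0 [:: x0] x0.
Proof. by rewrite /= !eqxx. Qed.

Lemma word_loop_walk w : walk e x0 (word_loop w ++ [:: x0]) x0.
Proof.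
elim: w => [|a w IH]; first exact: walk1.
rewrite /= -catA; exact: (walk_cat e_refl (letter_loop_walk a) IH).
Qed.

Lemma spell_letter_loop a : cl (spell (letter_loop a)) = cl [:: a].
Proof.
case: a => i [] /=; first exact: (comb_label cb).
rewrite /letter_loop /= (spell_rev e_refl e_sym labC (comb_gen cb i)).
by rewrite (comb_label cb) -pres_class_winv.
Qed.

Lemma spell_word_loop w : cl (spell (word_loop w ++ [:: x0])) = cl w.
Proof.
elim: w => [|a w IH] //=; rewrite -catA.
rewrite (spell_cat e_refl labC (letter_loop_walk a) (word_loop_walk w)) IH.
by rewrite spell_letter_loop -pres_class_cat.
Qed.

Lemma letter_loop_cancel i b s :
  htpy e (letter_loop (i, b) ++ letter_loop (i, ~~ b) ++ x0 :: s) (x0 :: s).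
Proof.
have -> : letter_loop (i, ~~ b) = rev (letter_loop (i, b)).
  by case: b; rewrite /letter_loop /= ?revK.
exact: (htpy_rev s e_refl e_sym (letter_loop_walk (i, b))).
Qed.

(** Relators are taken from a list S of their own: free cancellation (S empty)
already holds in any combed graph, while the relators of R become
null-homotopic only after discs have been attached. *)
Lemma word_loop_equiv (S : seq (word k)) u v s :
  (forall r, r \in S -> htpy e (word_loop r ++ [:: x0]) [:: x0]) ->
  pres_equiv S u v -> htpy e (word_loop u ++ x0 :: s) (word_loop v ++ x0 :: s).
Proof.
have headE w : exists s', word_loop w ++ x0 :: s = x0 :: s'.
  have := word_loop_walk w; case: (word_loop w) => [|a q]; first by exists s.
  by move=> /= /and3P[/eqP-> _ _]; eexists.
move=> S0; elim=> {u v} [u|u v _|u v w _ uv _|u v i b|u v r rS].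
- exact: HtpyRefl.
- exact: HtpySym.
- exact: HtpyTrans.
- rewrite !word_loop_cat !word_loop_cons -!catA; apply: htpy_catl.
  case: (headE v) => s' ->; exact: letter_loop_cancel.
- rewrite !word_loop_cat -!catA; apply: htpy_catl.
  case: (headE v) => s' ->.
  apply: HtpyTrans (HtpySym (HtpyStutter e (word_loop r) x0 s')) _.
  have := htpy_catr (x0 :: s') (S0 r rS); rewrite -catA => rS0.
  exact: HtpyTrans rS0 (HtpyStutter e [::] x0 s').
Qed.

(** Comb the walk edge by edge: the generator loops accumulate on the left. *)
Lemma comb_walk p v : walk e x0 p v ->
  htpy e p (word_loop (spell p) ++ x0 :: tail v).
Proof.
case: p => [|a p] //= /and3P[/eqP-> pp /eqP<-] {a}.
rewrite -/(spell (x0 :: p)).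
elim/last_ind: p pp => [|p y IH].
  by rewrite /= (comb_base cb) => _; exact: HtpyRefl.
rewrite rcons_path last_rcons => /andP[/IH {}IH py].
rewrite spell_rcons word_loop_cat -catA.
apply: HtpyTrans (htpy_catl _ (comb_edge cb py)).
by rewrite -rcons_cons -!cats1 -!cat_cons catA; apply: htpy_catr.
Qed.

End Combing.

(** * The theta graph: generators *)

Section Theta.
Variables (k : nat) (R : seq (word k)).

(** The two hubs are inl false, the base point, and inl true; the vertices inr z
are the midpoints of the arcs between them.  The arc through inr None is the
common way back of all generators. *)
Definition theta : Type := (bool + option 'I_k)%type.
HB.instance Definition _ := Finite.on theta.

Definition theta_base : theta := inl false.

Definition theta_adj : rel theta := fun u v =>
  match u, v with
  | inl a, inl b => a == b
  | inr i, inr j => i == j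
  | _, _ => true
  end.

(** The arc through inr None and the first halves of the other arcs form a
spanning tree; only the edges outside of it carry a letter. *)
Definition theta_label (u v : theta) : word k :=
  match u, v with
  | inr (Some i), inl true => [:: (i, true)]
  | inl true, inr (Some i) => [:: (i, false)]
  | _, _ => [::]
  end.

Definition theta_gen (i : 'I_k) : seq theta :=
  [:: theta_base; inr (Some i); inl true; inr None; theta_base].

Definition theta_tail (v : theta) : seq theta :=
  match v with
  | inl false => [::]
  | inl true => [:: inr None; inl true]
  | inr z => [:: inr z]
  end.

Lemma theta_adj_refl : reflexive theta_adj.
Proof. by case=> a /=. Qed.

Lemma theta_adj_sym : symmetric theta_adj.
Proof. by move=> [a|i] [b|j] //=; rewrite eq_sym. Qed.

(** The graph is bipartite, so every triangle is degenerate. *)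
Lemma theta_cocycle : cocycle R theta_adj theta_label.
Proof.
have cancel i b : pres_class R ([:: (i, b)] ++ [:: (i, ~~ b)]) = pres_class R [::].
  by apply/pres_classP/(PresCancel R [::] [::]).
move=> u v w; rewrite -pres_class_cat.
case: u v w => [[]|[i|]] [[]|[j|]] [[]|[l|]] //= /eqP uv /eqP vw /eqP uw.
all: try (case: uv => ?); try (case: uw => ?); try (case: vw => ?); subst.
all: first [by [] | exact: (cancel _ true) | exact: (cancel _ false)].
Qed.

Lemma theta_combing :
  combing R theta_adj theta_base theta_label theta_gen theta_tail.
Proof.
have e_refl := theta_adj_refl; have e_sym := theta_adj_sym.
have back s (u v : theta) t : theta_adj u v ->
    htpy theta_adj (s ++ [:: u, v, u & t]) (s ++ u :: t).
  exact: htpy_backtrack.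
have stut s (u : theta) t : htpy theta_adj (s ++ [:: u, u & t]) (s ++ u :: t).
  exact: HtpyStutter.
split=> //; first exact: theta_cocycle.
move=> [[]|[i|]] [[]|[j|]] //= uv; rewrite /word_loop /letter_loop /=;
  try exact: HtpyRefl.
- exact: (stut [:: theta_base; inr None]).
- apply: HtpySym; rewrite /rev /=.
  apply: HtpyTrans (stut [:: theta_base; inr None; inl true; inr (Some j)] _ _) _.
  exact: (back [:: theta_base; inr None; inl true] (inr (Some j)) theta_base [::]).
- exact: (back [:: theta_base] (inr None) (inl true) [::]).
- exact: (stut [::]).
- apply: HtpySym.
  apply: HtpyTrans (stut [:: theta_base; inr (Some i); inl true; inr None] _ _) _.
  apply: HtpyTrans
    (back [:: theta_base; inr (Some i); inl true] (inr None) theta_base _ _) _ => //.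
  exact: (back [:: theta_base; inr (Some i)] (inl true) (inr None) [::]).
- exact: (back [::] theta_base (inr (Some i)) [::]).
- case/eqP: uv => ->; exact: (stut [:: theta_base]).
- exact: (back [::] theta_base (inr None) [::]).
- exact: (stut [:: theta_base]).
Qed.

End Theta.

(** * Attaching discs: relators *)

Section Discs.
Variables (k : nat) (R : seq (word k)) (V : finType) (e : rel V) (x0 : V).
Variables (lab : V -> V -> word k) (gen : 'I_k -> seq V) (tail : V -> seq V).
Variables (I : finType) (N : nat) (b : I -> nat -> V).

(** The disc with index i is glued along the loop b i 0, b i 1, ..., which rests
at x0 from time N on, so that all rims have the same number of vertices.  Rim
vertices are indexed by the times 0 to N, and None is the centre. *)
Definition discs : Type := (V + I * option 'I_N.+1)%type.
HB.instance Definition _ := Finite.on discs.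

(** A rim vertex meets the loop at two consecutive times, so consecutive rim
vertices share a neighbour on the loop and the annulus is triangulated. *)
Definition touches (i : I) (j : nat) (v : V) : bool :=
  (v == b i j) || (v == b i j.+1).

(** The rim is closed up by the edge between the times N and 0. *)
Definition ring_adj (j j' : nat) : bool :=
  [|| (j <= j'.+1) && (j' <= j.+1), (j == 0) && (j' == N) | (j == N) && (j' == 0)].

Definition discs_adj : rel discs := fun u v =>
  match u, v with
  | inl u, inl v => e u v
  | inl v, inr (i, Some j) | inr (i, Some j), inl v => touches i j v
  | inr (i, Some j), inr (i', Some j') => (i == i') && ring_adj j j'
  | inr (i, _), inr (i', _) => i == i'
  | _, _ => false
  end.

Definition arc (i : I) (j : nat) : seq V := mkseq (b i) j.+1.

(** The label of the edge from the rim vertex at time j to v is what the loop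
spells up to time j and then on to v: the path from x0 through the disc to v
sweeps across to this one. *)
Definition spoke_word (i : I) (j : nat) (v : V) : word k :=
  spell lab (rcons (arc i j) v).

Definition discs_label (u v : discs) : word k :=
  match u, v with
  | inl u, inl v => lab u v
  | inr (i, Some j), inl v => spoke_word i j v
  | inl v, inr (i, Some j) => winv (spoke_word i j v)
  | _, _ => [::]
  end.

Definition old (v : V) : discs := inl v.
(** The time is a natural number, so that sweeps can go by induction on it. *)
Definition rim (i : I) (j : nat) : discs := inr (i, Some (inord j)).
Definition centre (i : I) : discs := inr (i, None).

Definition discs_gen (i : 'I_k) : seq discs := map old (gen i).

(** All vertices of a disc are reached from its rim vertex at time 0 through the
centre. *)
Definition discs_tail (u : discs) : seq discs :=
  match u with
  | inl v => map old (tail v)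
  | inr (i, None) => [:: rim i 0; centre i]
  | inr (i, Some j) => [:: rim i 0; centre i; rim i j]
  end.

Hypothesis cb : combing R e x0 lab gen tail.
Hypothesis b0 : forall i, b i 0 = x0.
Hypothesis bN : forall i j, N <= j -> b i j = x0.
Hypothesis b_adj : forall i j, e (b i j) (b i j.+1).
Hypothesis b_rel : forall i, pres_class R (spell lab (arc i N)) = 1%g.

Let e_refl := comb_refl cb.
Let e_sym := comb_sym cb.
Let labC := comb_cocycle cb.
Local Notation cl := (pres_class R).
Local Notation spell := (spell lab).
Local Notation e' := discs_adj.

Lemma discs_adj_refl : reflexive e'.
Proof.
by case=> [v|[i [j|]]] /=; rewrite ?e_refl ?eqxx //= /ring_adj leqnSn.
Qed.

Lemma discs_adj_sym : symmetric e'.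
Proof.
case=> [u|[i [j|]]] [v|[i' [j'|]]] //=.
by rewrite eq_sym; congr (_ && _); rewrite /ring_adj; lia.
Qed.

Lemma touches_adj i j v : touches i j v -> e (b i j) v && e (b i j.+1) v.
Proof.
by case/orP=> /eqP->; rewrite ?e_refl ?b_adj // e_sym b_adj.
Qed.

Lemma arcS i j : arc i j.+1 = rcons (arc i j) (b i j.+1).
Proof. exact: mkseqS. Qed.

Lemma arc_walk i j : walk e x0 (arc i j) (b i j).
Proof.
elim: j => [|j IH]; first by rewrite /= b0 !eqxx.
by rewrite arcS; apply: walk_rcons IH _.
Qed.

Local Open Scope group_scope.

Lemma spoke_wordE i j v :
  cl (spoke_word i j v) = cl (spell (arc i j)) * cl (lab (b i j) v).
Proof.
rewrite /spoke_word; case: (arc i j) (arc_walk i j) => // a p /and3P[_ _ /eqP lp].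
by rewrite spell_rcons lp pres_class_cat.
Qed.

(** This covers a loop that backtracks at time j, when v = b i j = b i j.+2: the
two edges of the backtrack have inverse labels. *)
Lemma spoke_word_next i j v : touches i j v ->
  cl (spoke_word i j v) = cl (spoke_word i j.+1 v).
Proof.
case/touches_adj/andP=> ev ev'.
rewrite !spoke_wordE arcS -/(spoke_word i j _) spoke_wordE -mulgA.
by rewrite (labC (b_adj i j) ev').
Qed.

(** Labels agree along the rim, and also across its closing edge, because the
label of the whole loop is trivial in the presented group. *)
Lemma spoke_word_ring i j j' v : j <= N -> j' <= N -> ring_adj j j' ->
  touches i j v -> touches i j' v -> cl (spoke_word i j v) = cl (spoke_word i j' v).
Proof.
have seam w : touches i N w -> cl (spoke_word i 0 w) = cl (spoke_word i N w).
  rewrite /touches !bN // orbb => /eqP->.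
  rewrite !spoke_wordE b0 bN // b_rel /= pres_class_nil.
  by rewrite (lab_refl e_refl labC).
move=> jN jN' /or3P[/andP[jj' jj]|/andP[/eqP-> /eqP->]|/andP[/eqP-> /eqP->]] tj tj'.
- case: (ltngtP j j') => [lt|lt|-> //].
    have -> : j' = j.+1 by lia.
    exact: spoke_word_next.
  have -> : j = j'.+1 by lia.
  exact/esym/spoke_word_next.
- exact: seam.
- exact/esym/seam.
Qed.

(** If u and v both touch the rim at time j, then u, v and b i j form a
triangle of the old graph. *)
Lemma spoke_word_lab i j u v : touches i j u -> touches i j v -> e u v ->
  cl (spoke_word i j u) * cl (lab u v) = cl (spoke_word i j v).
Proof.
move=> /touches_adj/andP[eu _] /touches_adj/andP[ev _] uv.
by rewrite !spoke_wordE -mulgA (labC eu uv ev).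
Qed.

Lemma discs_cocycle : cocycle R e' discs_label.
Proof.
have ordN (j : 'I_N.+1) : j <= N by rewrite -ltnS.
have ring i i' (j j' : 'I_N.+1) v : i == i' -> ring_adj j j' ->
    touches i j v -> touches i' j' v ->
    cl (spoke_word i j v) = cl (spoke_word i' j' v).
  by move=> /eqP->; apply: spoke_word_ring.
move=> [u|[i [j|]]] [v|[i' [j'|]]] [w|[i'' [j''|]]] //=;
  rewrite ?pres_class_winv ?pres_class_nil ?mulg1 ?mul1g //.
- exact: labC.
- move=> uv tv tu; apply: (mulgI (cl (spoke_word i'' j'' u))).
  by rewrite mulgA (spoke_word_lab tu tv uv) !mulgV.
- move=> tu tw uw; rewrite -(spoke_word_lab tu tw uw).
  by rewrite mulgA mulVg mul1g.
- by move=> tu /andP[ii jj] tu'; rewrite (ring _ _ _ _ _ ii jj tu tu').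
- move=> tv tw vw; exact: spoke_word_lab.
- move=> tv tv' /andP[ii jj]; rewrite (ring _ _ _ _ _ ii jj tv tv').
  by rewrite mulgV.
- by move=> /andP[ii jj] tw tw'; rewrite (ring _ _ _ _ _ ii jj tw' tw).
Qed.

Lemma rim_old i j v : j <= N -> touches i j v -> e' (rim i j) (old v).
Proof. by move=> jN; rewrite /= inordK. Qed.

Lemma rim_rim i j j' : j <= N -> j' <= N -> ring_adj j j' -> e' (rim i j) (rim i j').
Proof. by move=> jN j'N; rewrite /= eqxx !inordK. Qed.

Lemma centre_rim i j : e' (centre i) (rim i j).
Proof. by rewrite /= eqxx. Qed.

(** Sweeping the annulus: an initial segment of the boundary loop is pushed
across it onto the rim, and the rim is collapsed onto the centre. *)
Lemma sweep i j : j <= N ->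
  htpy e' (map old (arc i j) ++ [:: rim i j])
          [:: old x0; rim i 0; centre i; rim i j].
Proof.
elim: j => [|j IH] jN.
  rewrite /= b0; apply: HtpySym.
  apply: (htpy_backtrack [:: old x0] [::] discs_adj_refl discs_adj_sym).
  by rewrite discs_adj_sym centre_rim.
have jN' := ltnW jN.
have tj : touches i j (b i j) by rewrite /touches eqxx.
have tj1 : touches i j (b i j.+1) by rewrite /touches eqxx orbT.
have tj2 : touches i j.+1 (b i j.+1) by rewrite /touches eqxx.
have jj : ring_adj j j.+1 by rewrite /ring_adj leqnn; lia.
have := IH jN'; rewrite arcS /arc mkseqS !map_rcons -!cats1 -!catA /= => {}IH.
set s := map old _ in IH *.
apply: (HtpyTrans (q := s ++ [:: old (b i j); rim i j; old (b i j.+1); rim i j.+1])).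
  apply: HtpySym; apply: HtpyTriangle => //; last exact: b_adj.
  - by rewrite discs_adj_sym; apply: rim_old.
  - exact: rim_old.
apply: (HtpyTrans (q := s ++ [:: old (b i j); rim i j; rim i j.+1])).
  have r1 := rim_old jN' tj1; have r2 := rim_old jN tj2.
  rewrite discs_adj_sym in r2.
  have := HtpyTriangle (s ++ [:: old (b i j)]) [::] r1 r2 (rim_rim i jN' jN jj).
  by rewrite -!catA.
have := htpy_catr [:: rim i j.+1] IH; rewrite -catA => {}IH.
apply: HtpyTrans IH _.
apply: (HtpyTriangle [:: old x0; rim i 0]); [exact: centre_rim| |exact: centre_rim].
exact: rim_rim.
Qed.

(** After the sweep the boundary loop has become x0, rim 0, centre, rim N, x0.
The closing edge of the rim removes the centre, and then both rim vertices
disappear because they are adjacent to each other and to x0. *)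
Lemma arc_null i : htpy e' (map old (arc i N)) [:: old x0].
Proof.
have t0 : touches i 0 x0 by rewrite /touches b0 eqxx.
have tN : touches i N x0 by rewrite /touches bN ?eqxx.
have r0 := rim_old (leq0n N) t0; have rN := rim_old (leqnn N) tN.
have r0' := r0; rewrite discs_adj_sym in r0'.
have rN' := rN; rewrite discs_adj_sym in rN'.
have r0N : e' (rim i 0) (rim i N) by apply: rim_rim; rewrite // /ring_adj; lia.
have back u v s : e' u v -> htpy e' [:: u, v, u & s] (u :: s).
  exact: (htpy_backtrack [::] _ discs_adj_refl discs_adj_sym).
apply: (HtpyTrans (q := (map old (arc i N) ++ [:: rim i N]) ++ [:: old x0])).
  rewrite /arc mkseqS map_rcons -cats1 -!catA bN //=; apply: HtpySym.
  exact/htpy_catl/back.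
apply: HtpyTrans (htpy_catr _ (sweep i (leqnn N))) _ => /=.
apply: HtpyTrans (HtpyTriangle [:: old x0] _ _ (centre_rim i N) r0N) _.
  by rewrite discs_adj_sym centre_rim.
apply: HtpyTrans (HtpyTriangle [::] _ r0' r0N rN') _.
exact: back.
Qed.

Lemma sweep_spoke i j v : j <= N -> touches i j v ->
  htpy e' (map old (rcons (arc i j) v) ++ [:: rim i j])
          [:: old x0; rim i 0; centre i; rim i j].
Proof.
move=> jN tv; apply: HtpyTrans (sweep i jN).
rewrite /arc mkseqS !map_rcons -!cats1 -!catA /=.
have tj : touches i j (b i j) by rewrite /touches eqxx.
case/andP: (touches_adj tv) => ev _.
by apply: HtpyTriangle; rewrite ?[e' _ (rim i j)]discs_adj_sym ?rim_old.
Qed.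

Lemma map_word_loop w : map old (word_loop gen w) = word_loop discs_gen w.
Proof.
elim: w => // a w IH; rewrite !word_loop_cons map_cat IH; congr (_ ++ _).
by case: a => i [] //=; rewrite /letter_loop /= map_rev.
Qed.

Lemma htpy_old p q : htpy e p q -> htpy e' (map old p) (map old q).
Proof. exact: htpy_map. Qed.

Lemma disc_null i w : htpy e (arc i N) (word_loop gen w ++ [:: x0]) ->
  htpy e' (word_loop discs_gen w ++ [:: old x0]) [:: old x0].
Proof.
move=> /htpy_old/HtpySym; rewrite map_cat map_word_loop => /HtpyTrans; apply.
exact: arc_null.
Qed.

(** Here the combing of the old graph is used: it rewrites the boundary segment
that a spoke is compared with as a product of generator loops. *)
Lemma spoke_htpy i j v : j <= N -> touches i j v ->
  htpy e' (map old (rcons (arc i j) v))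
          (word_loop discs_gen (spoke_word i j v) ++ old x0 :: map old (tail v)).
Proof.
move=> jN tv; have wv : walk e x0 (rcons (arc i j) v) v.
  by apply: walk_rcons (arc_walk i j) _; case/andP: (touches_adj tv).
by have := htpy_old (comb_walk cb wv); rewrite map_cat map_word_loop.
Qed.

Lemma spoke_in i j v : j <= N -> touches i j v ->
  htpy e' (old x0 :: rcons (map old (tail v)) (rim i j))
          (word_loop discs_gen (winv (spoke_word i j v)) ++
           [:: old x0; rim i 0; centre i; rim i j]).
Proof.
move=> jN tv; set w := spoke_word i j v.
apply: HtpyTrans (htpy_catl _ (sweep_spoke jN tv)).
have := htpy_catl (word_loop discs_gen (winv w))
  (htpy_catr [:: rim i j] (spoke_htpy jN tv)).
move=> /HtpySym; apply: HtpyTrans.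
have no_rel r : r \in ([::] : seq (word k)) ->
  htpy e (word_loop gen r ++ [:: x0]) [:: x0] by [].
have := word_loop_equiv cb (tail v) no_rel (pres_mulVw [::] w).
move=> /HtpySym/htpy_old/(htpy_catr [:: rim i j]).
by rewrite word_loop_cat -catA !map_cat !map_word_loop -!catA /= -cats1.
Qed.

Lemma spoke_out i j v : j <= N -> touches i j v ->
  htpy e' [:: old x0; rim i 0; centre i; rim i j; old v]
          (word_loop discs_gen (spoke_word i j v) ++ old x0 :: map old (tail v)).
Proof.
move=> jN tv; apply: HtpyTrans (spoke_htpy jN tv).
have := htpy_catr [:: old v] (sweep_spoke jN tv); move/HtpySym/HtpyTrans; apply.
rewrite map_rcons -cats1 -!catA.
apply: (htpy_backtrack _ [::] discs_adj_refl discs_adj_sym).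
by rewrite discs_adj_sym rim_old.
Qed.

(** Edges of the old graph are combed as before, spokes by spoke_in and
spoke_out, and the edges inside a disc by the triangles at its centre. *)
Lemma discs_combing : combing R e' (old x0) discs_label discs_gen discs_tail.
Proof.
have ordN (j : 'I_N.+1) : j <= N by rewrite -ltnS.
have rimE i (j : 'I_N.+1) : inr (i, Some j) = rim i j by rewrite /rim inord_val.
split.
- exact: discs_adj_refl.
- exact: discs_adj_sym.
- exact: discs_cocycle.
- move=> i; have := comb_gen cb i; rewrite /discs_gen; case: (gen i) => //= a p.
  case/and3P=> /eqP-> pp /eqP lp; rewrite last_map lp !eqxx andbT path_map.
  by rewrite (eq_path (e' := e)).
- by move=> i; rewrite -(comb_label cb) (spell_map (lab := lab)).
- by rewrite /= (comb_base cb).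
move=> [u|[i [j|]]] [v|[i' [j'|]]] // uv.
- have := htpy_old (comb_edge cb uv).
  by rewrite map_cat map_word_loop /= map_rcons.
- by have := spoke_in (ordN j') uv; rewrite /= -(rimE i' j').
- by have := spoke_out (ordN j) uv; rewrite /= -(rimE i j).
- case/andP: uv => /eqP<- jj; rewrite /= !rimE.
  by apply: (HtpyTriangle [:: old x0; rim i 0]); rewrite ?centre_rim ?rim_rim.
- move/eqP: uv => <-.
  apply: (htpy_backtrack [:: old x0; rim i 0] [::] discs_adj_refl discs_adj_sym).
  by rewrite centre_rim.
- move/eqP: uv => <-; rewrite /= rimE; exact: HtpyRefl.
- move/eqP: uv => <-; exact: (HtpyStutter _ [:: old x0; rim i 0]).
Qed.

End Discs.

(** * Every finite graph is a digital image *)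

Section Embedding.
Variables (V : finType) (e : rel V).
Hypotheses (e_refl : reflexive e) (e_sym : symmetric e).
Local Open Scope ring_scope.

(** The graph distance truncated at 2.  Using it, for all u, as coordinates
keeps adjacent vertices within distance 1, and separates a vertex u from its
non-neighbours in the coordinate of u. *)
Definition graph_dist (u v : V) : int :=
  if u == v then 0 else if e u v then 1 else 2.

Definition graph_point (v : V) : 'rV[int]_#|V| :=
  \row_i graph_dist (enum_val i) v.

Lemma graph_point_adj u v : adjacent (graph_point u) (graph_point v) = e u v.
Proof.
apply/forallP/idP => [H|uv i].
  have := H (enum_rank u); rewrite !mxE enum_rankK /graph_dist eqxx.
  by case: eqP => [->|_] //; case: (e u v).
rewrite !mxE /graph_dist.
have [iu|_] := eqVneq (enum_val i) u; have [iv|_] := eqVneq (enum_val i) v => //.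
- by rewrite iu uv.
- by rewrite iv e_sym uv.
- by do 2!case: (e (enum_val i) _).
Qed.

Lemma graph_point_inj : injective graph_point.
Proof.
move=> u v /rowP/(_ (enum_rank u)); rewrite !mxE enum_rankK /graph_dist eqxx.
by case: eqP => // _; case: (e u v).
Qed.

Definition graph_image : {fset 'rV[int]_#|V|} := [fset graph_point v | v in V]%fset.

Definition image_of (v : V) : graph_image :=
  FSetSub (in_imfset imfset_key graph_point (isT : v \in V)).

Lemma image_of_adj u v : image_adj (image_of u) (image_of v) = e u v.
Proof. exact: graph_point_adj. Qed.

Lemma image_of_bij : bijective image_of.
Proof.
have surj x : exists v, image_of v == x.
  case: x => y yX; have /imfsetP[v _ yv] := yX.
  by exists v; apply/eqP/val_inj; rewrite /= -yv.
exists (fun x => xchoose (surj x)) => [v|x]; last exact/eqP/(xchooseP (surj x)).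
apply: graph_point_inj.
by have /eqP/(congr1 val) := xchooseP (surj (image_of v)).
Qed.

End Embedding.

(** * The fundamental group of a combed graph *)

Lemma loop_of_list n (X : {fset 'rV[int]_n}) (x0 : X) p :
  walk (@image_adj n X) x0 p x0 -> exists a : any_loop x0, anylist a = p.
Proof.
move=> wp; case: p wp (wp) => // c p _ wp; set s := c :: p in wp *.
pose f := [ffun i : 'I_(size p).+1 => nth x0 s i].
have fs : tolist f = s by apply: (tolistP (x0 := x0)) => // i; rewrite ffunE.
have lf : is_based_loop x0 f.
  apply/is_based_loopP; rewrite fs lloopE //; exact: image_adj_refl.
by exists (Tagged (loop x0) (mk_loop lf)).
Qed.

Section FundamentalGroupOfGraph.
Variables (k : nat) (R : seq (word k)) (V : finType) (e : rel V) (x0 : V).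
Variables (lab : V -> V -> word k) (gen : 'I_k -> seq V) (tail : V -> seq V).
Hypothesis cb : combing R e x0 lab gen tail.
Hypothesis relators_null : forall r, r \in R ->
  htpy e (word_loop gen r ++ [:: x0]) [:: x0].
Variables (n : nat) (X : {fset 'rV[int]_n}) (f : V -> X) (g : X -> V).
Hypotheses (fK : cancel f g) (gK : cancel g f).
Hypothesis f_adj : forall u v, image_adj (f u) (f v) = e u v.

Let e_refl := comb_refl cb.
Let e_sym := comb_sym cb.
Let labC := comb_cocycle cb.

(** A loop of the image, read as a walk in the graph. *)
Definition graph_list (a : any_loop (f x0)) : seq V := map g (anylist a).

Lemma graph_list_walk a : walk e x0 (graph_list a) x0.
Proof.
have := anyloopP a; rewrite lloopE; last exact: image_adj_refl.
rewrite /graph_list; case: (anylist a) => //= c p /and3P[/eqP-> pp /eqP lp].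
rewrite last_map lp fK eqxx andbT -[x in path e x]fK path_map.
by apply: sub_path pp => u v; rewrite /= -f_adj !gK.
Qed.

Lemma graph_list_lequiv a b :
  lequiv (@image_adj n X) (f x0) (anylist a) (anylist b) <->
  lequiv e x0 (graph_list a) (graph_list b).
Proof.
split=> [ab|]; last first.
  have mapK a' : map f (graph_list a') = anylist a'.
    by rewrite -map_comp map_id_in // => y _; apply: gK.
  rewrite -(mapK a) -(mapK b); apply: lequiv_map => u v; by rewrite f_adj.
rewrite -[x0]fK; apply: lequiv_map ab => u v.
by rewrite -{1}(gK u) -{1}(gK v) f_adj.
Qed.

Definition holonomy (x : pi1 (f x0)) : presented R :=
  pres_class R (spell lab (graph_list (pi1_repr x))).

Lemma holonomyE a : holonomy (pi1_class a) = pres_class R (spell lab (graph_list a)).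
Proof.
apply: (lequiv_spell e_refl labC (graph_list_walk _) (graph_list_walk _)).
exact/graph_list_lequiv/pi1_repr_class.
Qed.

Lemma holonomyM : {morph holonomy : x y / (x * y)%g}.
Proof.
move=> x y; rewrite -(pi1_reprK x) -(pi1_reprK y).
rewrite -[(_ * _)%g]/(pi1_mul _ _) pi1_mulE !holonomyE.
rewrite /graph_list anylist_cat map_cat.
exact: (spell_cat e_refl labC (graph_list_walk _) (graph_list_walk _)).
Qed.

(** Both loops are homotopic to the products of generator loops that they
spell, and these are homotopic as soon as the words agree in the presented
group. *)
Lemma holonomy_inj : injective holonomy.
Proof.
move=> x y; rewrite -(pi1_reprK x) -(pi1_reprK y) !holonomyE => /pres_classP xy.
apply/pi1_classE/graph_list_lequiv/htpy_lequiv => //; last exact: graph_list_walk.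
apply: HtpyTrans (comb_walk cb (graph_list_walk _)) _.
apply: HtpyTrans (HtpySym (comb_walk cb (graph_list_walk _))).
exact: (word_loop_equiv cb (tail x0) relators_null xy).
Qed.

Lemma holonomy_surj y : exists x, holonomy x = y.
Proof.
have wy := word_loop_walk cb (pres_repr y).
have wf : walk (@image_adj n X) (f x0)
    (map f (word_loop gen (pres_repr y) ++ [:: x0])) (f x0).
  case: (_ ++ _) wy => //= c p /and3P[/eqP-> pp /eqP lp].
  rewrite last_map lp !eqxx andbT path_map.
  by apply: sub_path pp => u v; rewrite /= f_adj.
have [a ap] := loop_of_list wf; exists (pi1_class a); rewrite holonomyE.
rewrite /graph_list ap -map_comp map_id_in; last by move=> u _; apply: fK.
by rewrite (spell_word_loop cb) pres_reprK.
Qed.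

Lemma pi1_presented : isomorphic (pi1 (f x0)) (presented R).
Proof.
have [h hK] := choice holonomy_surj.
exists holonomy; last exact: holonomyM.
by exists h; [move=> x; apply: holonomy_inj; rewrite hK|exact: hK].
Qed.

End FundamentalGroupOfGraph.

Lemma presented_pi1 (k : nat) (R : seq (word k)) (V : finType) (e : rel V) (x0 : V)
    (lab : V -> V -> word k) (gen : 'I_k -> seq V) (tail : V -> seq V) :
  combing R e x0 lab gen tail ->
  (forall r, r \in R -> htpy e (word_loop gen r ++ [:: x0]) [:: x0]) ->
  exists (n : nat) (X : {fset 'rV[int]_n}) (y0 : X),
    isomorphic (pi1 y0) (presented R).
Proof.
move=> cb relators_null; have [g fK gK] := image_of_bij e.
exists #|V|, (graph_image e), (image_of e x0).
exact: (pi1_presented cb relators_null fK gK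
          (image_of_adj (comb_refl cb) (comb_sym cb))).
Qed.

Lemma isomorphic_sym (G H : groupType) : isomorphic G H -> isomorphic H G.
Proof.
case=> f [g fK gK] fM; exists g; first by exists f.
by move=> x y; apply: (can_inj fK); rewrite fM !gK.
Qed.

Lemma isomorphic_trans (G H K : groupType) :
  isomorphic G H -> isomorphic H K -> isomorphic G K.
Proof.
case=> f fb fM [g gb gM]; exists (g \o f); first exact: bij_comp.
by move=> x y /=; rewrite fM gM.
Qed.

(** * The theorem *)

Lemma mkseq_nth_pad (T : Type) (x : T) (s : seq T) N : size s <= N ->
  mkseq (nth x s) N.+1 = s ++ nseq (N - size s).+1 x.
Proof.
move=> sN; apply: (@eq_from_nth _ x).
  by rewrite size_mkseq size_cat size_nseq addnS subnKC.
move=> j; rewrite size_mkseq => jN; rewrite nth_mkseq // nth_cat nth_nseq.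
by case: ltnP => // lj; rewrite nth_default // if_same.
Qed.

Lemma htpy_nseq (V : eqType) (e : rel V) m x : htpy e (nseq m.+1 x) [:: x].
Proof.
elim: m => [|m IH]; first exact: HtpyRefl.
exact: HtpyTrans (HtpyStutter e [::] x (nseq m x)) IH.
Qed.

Theorem theorem5p16 (G : groupType) (fpG : finitely_presented G) :
  exists (n : nat) (X : {fset 'rV[int]_n}) (x0 : X), isomorphic (pi1 x0) G.
Proof.
case: fpG => k [R isoG]; pose x0 := theta_base k.
have tc := theta_combing R.
pose loop_of (r : word k) := word_loop (@theta_gen k) r.
pose N := \max_(r <- R) size (loop_of r).
(* The boundary loop of the disc of r spells r, then rests at the base point,
   which is the default value of nth. *)
pose b (r : seq_sub R) (j : nat) := nth x0 (loop_of (val r)) j.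
have loop_size (r : seq_sub R) : size (loop_of (val r)) <= N.
  exact: (leq_bigmax_seq (F := fun r => size (loop_of r))) (valP r) isT.
have bN r j : N <= j -> b r j = x0.
  by move=> Nj; apply: nth_default; apply: leq_trans (loop_size r) Nj.
have arc_loop r : htpy (@theta_adj k) (arc b r N) (loop_of (val r) ++ [:: x0]).
  by rewrite /arc mkseq_nth_pad //; apply/htpy_catl/htpy_nseq.
have b_walk (r : seq_sub R) : walk (@theta_adj k) x0 (loop_of (val r) ++ [:: x0]) x0.
  exact: word_loop_walk tc (val r).
have bE r j : b r j = nth x0 (loop_of (val r) ++ [:: x0]) j.
  by rewrite cats1 nth_rcons_default.
have b0 r : b r 0 = x0.
  by rewrite bE; case: (_ ++ _) (b_walk r) => //= a q /and3P[/eqP].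
have b_adj r j : theta_adj (b r j) (b r j.+1).
  by rewrite !bE; apply: walk_nth (@theta_adj_refl k) (b_walk r).
have b_rel r : pres_class R (spell (@theta_label k) (arc b r N)) = 1%g.
  rewrite (htpy_spell (@theta_adj_refl k) (theta_cocycle R) (arc_loop r)).
  rewrite (spell_word_loop tc); apply/pres_classP.
  have := PresRel [::] [::] (valP r); rewrite cats0; exact.
have dc := discs_combing tc b0 bN b_adj b_rel.
have relators r (rR : r \in R) := disc_null tc b0 bN b_adj (arc_loop (SeqSub rR)).
have [n [X [y0 isoR]]] := presented_pi1 dc relators.
by exists n, X, y0; apply: isomorphic_trans isoR (isomorphic_sym isoG).
Qed.
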